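(* Let $d\ge1$ and let $\Theta_\sigma\in\mathcal{S}'(\mathbb{R}^{2d})$ be the distributional symplectic Fourier transform of $\Theta(x,\omega)=\mathrm{sinc}(x\omega)$, $(x,\omega)\in\mathbb{R}^d\times\mathbb{R}^d$. Then $\Theta_\sigma\notin L^p(\mathbb{R}^{2d})$ for any $1\le p\le\infty$.
   Context: For $x,\omega\in\mathbb{R}^d$, $x\omega$ denotes the scalar product. $\mathrm{sinc}(t)=\frac{\sin(\pi t)}{\pi t}$ for $t\ne0$ and $\mathrm{sinc}(0)=1$. The symplectic Fourier transform on $\mathbb{R}^{2d}$ is $\mathcal{F}_\sigma F(\zeta)=\int_{\mathbb{R}^{2d}}e^{-2\pi i\sigma(\zeta,z)}F(z)\,dz$ with $\sigma((x,\omega),(\zeta_1,\zeta_2))=\omega\cdot\zeta_1-x\cdot\zeta_2$, extended to $\mathcal{S}'(\mathbb{R}^{2d})$. The claim means that the distribution $\Theta_\sigma$ is not given by any $L^p$ function. *)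

(* Defs.v *)
From HB Require Import structures.
From mathcomp Require Import all_boot all_order all_algebra.
From mathcomp Require Import complex.
From mathcomp Require Import all_classical all_reals all_analysis.

Set Implicit Arguments.
Unset Strict Implicit.
Unset Printing Implicit Defensive.

Import Order.TTheory GRing.Theory Num.Theory.
Import numFieldNormedType.Exports.

Local Open Scope classical_set_scope.
Local Open Scope ring_scope.

(* The product sigma-algebra on row vectors; for T = R it is the Borel
   sigma-algebra of R^n. *)
Definition measure_row_display : measure_display -> measure_display.
Proof. exact. Qed.

Section row_measurable.
Context {d} {T : measurableType d} (n : nat).

Let coord : 'I_n -> 'rV[T]_n -> T := fun i v => v ord0 i.

Let row_set0 : g_sigma_preimage coord set0.
Proof. exact: sigma_algebra0. Qed.

Let row_setC A : g_sigma_preimage coord A -> g_sigma_preimage coord (~` A).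
Proof. exact: sigma_algebraC. Qed.

Let row_bigcup (F : _^nat) : (forall i, g_sigma_preimage coord (F i)) ->
  g_sigma_preimage coord (\bigcup_i (F i)).
Proof. exact: sigma_algebra_bigcup. Qed.

HB.instance Definition _ := @isMeasurable.Build (measure_row_display d)
  'rV[T]_n (g_sigma_preimage coord) row_set0 row_setC row_bigcup.

End row_measurable.

Lemma measurable_coord d (T : measurableType d) n (i : 'I_n) :
  measurable_fun [set: 'rV[T]_n] (fun v => v ord0 i).
Proof.
move=> _ Y mY; rewrite setTI; apply: sub_sigma_algebra.
rewrite -bigcup_seq/=; exists i => /=; first by rewrite mem_index_enum.
by exists Y => //; rewrite setTI.
Qed.

Lemma measurable_fun_row d1 d2 (T1 : measurableType d1)
    (T2 : measurableType d2) n (f : T1 -> 'rV[T2]_n) :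
  (forall i, measurable_fun [set: T1] (fun x => f x ord0 i)) ->
  measurable_fun [set: T1] f.
Proof.
move=> mf; pose G := \big[setU/set0]_(i < n)
  preimage_set_system setT (fun v : 'rV[T2]_n => v ord0 i) measurable.
apply: (@measurability _ _ _ _ _ f G) => // _ [A + <-].
rewrite /G -bigcup_seq => -[i _ [B mB <-]].
by rewrite !setTI -comp_preimage -[X in measurable X]setTI; exact: mf.
Qed.

Section lebesgue_row.
Context {R : realType}.

Definition row_cons n (p : measurableTypeR R * 'rV[R]_n) : 'rV[R]_n.+1 :=
  row_mx (p.1%:M : 'rV_1) p.2.

Definition row_uncons n (v : 'rV[R]_n.+1) : measurableTypeR R * 'rV[R]_n :=
  (v ord0 ord0, \row_j v ord0 (lift ord0 j)).

Lemma row_consK n : cancel (@row_cons n) (@row_uncons n).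
Proof.
move=> [x v]; congr pair.
  by rewrite /row_cons mxE; case: splitP => // j _; rewrite mxE !ord1.
apply/rowP => j; rewrite /row_cons !mxE; case: splitP => k /= /eqP.
  by rewrite ord1.
by rewrite /bump/= eqn_add2l => /eqP/val_inj <-.
Qed.

Lemma measurable_row_cons n : measurable_fun setT (@row_cons n).
Proof.
apply: measurable_fun_row => i.
have [j ->|->] := unliftP ord0 i.
  have -> : (fun p => row_cons p ord0 (lift ord0 j)) =
      (fun v : 'rV[R]_n => v ord0 j) \o snd.
    apply/funext => p.
    by have /(congr1 (fun q : _ * 'rV[R]_n => q.2 ord0 j)) := row_consK p;
      rewrite /= mxE.
  apply: measurableT_comp; first exact: measurable_coord.
  exact: measurable_snd.
have -> : (fun p : _ * 'rV[R]_n => row_cons p ord0 ord0) = fst.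
  by apply/funext => p; have /(congr1 fst) := row_consK p.
exact: measurable_fst.
Qed.

Lemma measurable_row_uncons n : measurable_fun setT (@row_uncons n).
Proof.
apply/measurable_fun_pairP; split.
  exact: (@measurable_coord _ R n.+1 ord0).
apply: measurable_fun_row => i.
have -> : (fun v => (@row_uncons n v).2 ord0 i) = fun v => v ord0 (lift ord0 i).
  by apply/funext => v; rewrite /= mxE.
exact: measurable_coord.
Qed.

Section cons_measure.
Local Open Scope ereal_scope.
Variables (n : nat) (mu : {sigma_finite_measure set 'rV[R]_n -> \bar R}).

Definition row_cons_measure : set 'rV[R]_n.+1 -> \bar R :=
  pushforward (lebesgue_measure \x mu) (@row_cons n).

Let row_cons_measure0 : row_cons_measure set0 = 0.
Proof. by rewrite /row_cons_measure /pushforward preimage_set0 measure0. Qed.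

Let row_cons_measure_ge0 A : 0 <= row_cons_measure A.
Proof. by rewrite /row_cons_measure /pushforward measure_ge0. Qed.

Let row_cons_measure_sigma_additive : semi_sigma_additive row_cons_measure.
Proof.
move=> F mF tF mUF; rewrite /row_cons_measure /pushforward preimage_bigcup.
have mpre A : measurable A -> measurable (@row_cons n @^-1` A).
  by move=> mA; rewrite -[X in measurable X]setTI; exact: measurable_row_cons.
apply: measure_semi_sigma_additive.
- by move=> k; exact: mpre.
- apply/trivIsetP => /= i j _ _ ij; rewrite -preimage_setI.
  by move/trivIsetP : tF => /(_ _ _ _ _ ij) ->//; rewrite preimage_set0.
- by rewrite -preimage_bigcup; exact: mpre.
Qed.

HB.instance Definition _ := isMeasure.Build _ _ _ row_cons_measure
  row_cons_measure0 row_cons_measure_ge0 row_cons_measure_sigma_additive.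

Let row_cons_measure_sigma_finite : sigma_finite setT row_cons_measure.
Proof.
have /sigma_finiteP[F [FT ndF mF]] := sigma_finiteT (@lebesgue_measure R).
have /sigma_finiteP[G [GT ndG mG]] := sigma_finiteT mu.
exists (fun k => @row_uncons n @^-1` (F k `*` G k)).
  rewrite -preimage_bigcup (_ : \bigcup_k _ = setT) ?preimage_setT//.
  apply/seteqP; split=> // -[x v] _.
  have [i _ Fix] : (\bigcup_k F k) x by rewrite -FT.
  have [j _ Gjv] : (\bigcup_k G k) v by rewrite -GT.
  exists (maxn i j) => //; split => /=.
    by move: x Fix; exact/subsetPset/ndF/leq_maxl.
  by move: v Gjv; exact/subsetPset/ndG/leq_maxr.
move=> k; have [mFk Fk] := mF k; have [mGk Gk] := mG k; split.
  rewrite -[X in measurable X]setTI.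
  by apply: measurable_row_uncons => //; exact: measurableX.
rewrite /row_cons_measure /pushforward -comp_preimage.
rewrite (_ : _ \o _ = id); last by apply/funext => p; exact: row_consK.
by rewrite preimage_id product_measure1E// lte_mul_pinfty// ge0_fin_numE.
Qed.

HB.instance Definition _ := Measure_isSigmaFinite.Build _ _ _ row_cons_measure
  row_cons_measure_sigma_finite.

End cons_measure.

(* Lebesgue measure on R^n, as the n-fold product of that of R. *)
Fixpoint lebesgue_row n : {sigma_finite_measure set 'rV[R]_n -> \bar R} :=
  if n is m.+1 then row_cons_measure (lebesgue_row m) else \d_ (0 : 'rV[R]_0).

End lebesgue_row.

Section complex_functions.
Context {R : realType}.

Definition expi (t : R) : R[i] := (cos t +i* sin t)%C.

Definition cintegral n (f : 'rV[R]_n -> R[i]) : R[i] :=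
  ((\int[lebesgue_row n]_z complex.Re (f z)) +i*
   (\int[lebesgue_row n]_z complex.Im (f z)))%C.

(* Classes modulo a.e. equality are represented by Borel functions; for p = +oo,
   Lnorm is the essential supremum. *)
Definition is_Lp n (p : \bar R) (f : 'rV[R]_n -> R[i]) : Prop :=
  [/\ measurable_fun setT (fun z => complex.Re (f z)),
      measurable_fun setT (fun z => complex.Im (f z)) &
      (Lnorm (lebesgue_row n) p (fun z => (Normc.normc (f z))%:E) < +oo)%E].

End complex_functions.

Section schwartz_space.
Context {R : realType} {n : nat}.

Definition partial (i : 'I_n) (f : 'rV[R]_n -> R) : 'rV[R]_n -> R :=
  fun z => 'D_(delta_mx 0 i) f z.

(* A sequence of coordinates encodes a multi-index, listing the derivations
   one by one. *)
Definition partials (s : seq 'I_n) (f : 'rV[R]_n -> R) : 'rV[R]_n -> R :=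
  foldr partial f s.

Definition monomial (a : 'I_n -> nat) (z : 'rV[R]_n) : R :=
  \prod_(i < n) z 0 i ^+ a i.

Definition real_schwartz (f : 'rV[R]_n -> R) : Prop :=
  forall s : seq 'I_n,
    (forall z, differentiable (partials s f) z) /\
    (forall a : 'I_n -> nat,
       exists M : R, forall z, `|monomial a z * partials s f z| <= M).

Definition schwartz (f : 'rV[R]_n -> R[i]) : Prop :=
  real_schwartz (fun z => complex.Re (f z)) /\
  real_schwartz (fun z => complex.Im (f z)).

(* Functionals are total on functions, but only their values on Schwartz
   functions are meaningful: equality in S' is [eq_distribution]. *)
Definition test_functional := ('rV[R]_n -> R[i]) -> R[i].

Definition eq_distribution (T U : test_functional) : Prop :=
  forall phi, schwartz phi -> T phi = U phi.

Definition regular_distribution (F : 'rV[R]_n -> R[i]) : test_functional :=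
  fun phi => cintegral (fun z => F z * phi z).

Definition in_Lp (p : \bar R) (T : test_functional) : Prop :=
  exists2 g, is_Lp p g & eq_distribution T (regular_distribution g).

End schwartz_space.
Arguments test_functional : clear implicits.

Section symplectic_fourier.
Context {R : realType} {d : nat}.

Definition dot (x w : 'rV[R]_d) : R := \sum_(i < d) x 0 i * w 0 i.

(* A phase space point is z = (x, w), with x = lsubmx z and w = rsubmx z. *)
Definition symplectic (z zeta : 'rV[R]_(d + d)) : R :=
  dot (rsubmx z) (lsubmx zeta) - dot (lsubmx z) (rsubmx zeta).

Definition symplectic_fourier (F : 'rV[R]_(d + d) -> R[i]) :
    'rV[R]_(d + d) -> R[i] :=
  fun zeta => cintegral (fun z => expi (- (2 * pi * symplectic zeta z)) * F z).

(* Duality for the bilinear pairing: since the symplectic form is antisymmetric,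
   the integral of (symplectic_fourier F) * phi is that of
   F z * symplectic_fourier phi (- z). *)
Definition distr_symplectic_fourier (T : test_functional R (d + d)) :
    test_functional R (d + d) :=
  fun phi => T (fun z => symplectic_fourier phi (- z)).

Definition sinc (t : R) : R := if t == 0 then 1 else sin (pi * t) / (pi * t).

Definition Theta (z : 'rV[R]_(d + d)) : R[i] :=
  (sinc (dot (lsubmx z) (rsubmx z)))%:C%C.

Definition Theta_sigma : test_functional R (d + d) :=
  distr_symplectic_fourier (regular_distribution Theta).

End symplectic_fourier.
Arguments Theta_sigma : clear implicits.

(* Main.v *)
Require Import Defs.
From mathcomp Require Import all_boot all_order all_algebra.
From mathcomp Require Import complex ring lra.
From mathcomp Require Import all_classical all_reals all_analysis.
From mathcomp Require Import measurable_realfun ess_sup_inf.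

(* The Gaussians G(x, w) = exp (- pi (|a x|^2 + |b w|^2)) are Schwartz, and
   writing sinc u as the integral of cos (pi t u) over t in [0, 1] gives

     <Theta_sigma, G> = I (a b),
     I (s) = \int_0^1 (1 + (s t / 2)^2)^(- d / 2) dt > 0,

   which depends on the product a b only.
   If Theta_sigma were a function g in L^p with p finite, take a = m, b = 1 / m:
   for every e > 0 there is K with |g| <= e + K |g|^p, so that
   I (1) <= e \int G + K \int |g|^p G; here \int G = 1, and the last integral
   tends to 0 with m -> oo by dominated convergence, as G tends to 0 outside of
   the null set where the first coordinate vanishes. Hence I (1) = 0, absurd.
   If g were bounded by C, then I (s) <= C \int G = C s^(- d) with a = s, b = 1,
   whereas s^d I (s) grows at least like ln s. *)

Set Implicit Arguments.
Unset Strict Implicit.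
Unset Printing Implicit Defensive.

Import Order.TTheory GRing.Theory Num.Theory.
Import numFieldNormedType.Exports.

Local Open Scope classical_set_scope.
Local Open Scope ring_scope.

(** * Gaussian integrals on the line *)

(** The value depends on a b only because (x, w) -> (k x, w / k) is symplectic and preserves the
    scalar product: it fixes [Theta] and commutes with the transform. A nonzero function fixed by
    this noncompact group cannot have an integrable p-th power for finite p. Hölder's inequality
    does not show this: along a = m, b = 1 / m the dual norm of G is constant. The decay must come
    from |g|^p, which serves as the dominating function; the pointwise split by e and K also covers
    p = 1. Constants are bounded and fixed by the group, so invariance cannot exclude p = oo; there
    a b has to grow. The case d = 1 is borderline: I (s) behaves like ln s / s. For larger d, s^d I
    (s) grows like a power of s, and a single logarithmic bound serves all d. Cosines change sign,
    so integrals are exchanged for 1 + cos, or al + be cos with |be| <= al; Tonelli's theorem then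
    suffices, and the added constant is subtracted once integrability is known. *)

Section gaussian1.
Context {R : realType}.
Implicit Types c x xi th : R.
Local Notation mu := (@lebesgue_measure R).

(** The factor pi matches the kernel exp (2 pi i x xi): the Fourier transform is then
    [c^-1 * gauss1 c^-1], without further constants. *)
Definition gauss1 c x : R := expR (- (pi * (c * x) ^+ 2)).

Lemma gauss1_ge0 c x : 0 <= gauss1 c x. Proof. exact: expR_ge0. Qed.

Lemma gauss1_le1 c x : gauss1 c x <= 1.
Proof. by rewrite -expR0 ler_expR oppr_le0 mulr_ge0 ?pi_ge0 ?sqr_ge0. Qed.

#[global] Instance is_derive_gauss1 c x :
  is_derive x 1 (gauss1 c) (- (2 * pi * c ^+ 2) * x * gauss1 c x).
Proof.
apply: is_derive_eq; rewrite /gauss1 !scaler1 /GRing.scale/=; ring.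
Qed.

Lemma continuous_gauss1 c : continuous (gauss1 c).
Proof.
move=> x; apply: differentiable_continuous.
by apply/derivable1_diffP; have [] := is_derive_gauss1 c x.
Qed.

Lemma measurable_gauss1 c : measurable_fun setT (gauss1 c).
Proof. by apply: continuous_measurable_fun; exact: continuous_gauss1. Qed.

Lemma integral_gauss1 c : 0 < c -> (\int[mu]_x (gauss1 c x)%:E = c^-1%:E)%E.
Proof.
move=> c0; pose k := Num.sqrt pi * c.
have sp : 0 < Num.sqrt pi :> R by rewrite sqrtr_gt0 pi_gt0.
have k0 : 0 < k by rewrite mulr_gt0.
have dF : derive1 (fun x : R => k * x) = cst k.
  by apply/funext => x; rewrite derive1Ml// derive1_id mulr1.
have : (\int[mu]_x (gauss_fun x)%:E =
  \int[mu]_x (((gauss_fun \o (fun x => k * x)) *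
    derive1 (fun x : R => k * x))%R x)%:E)%E.
  apply: increasing_ge0_integration_by_substitutionT.
  - by move=> x y xy; rewrite ltr_pM2l.
  - by rewrite dF; move=> x; exact: cvg_cst.
  - rewrite dF; exact: is_cvg_cst.
  - rewrite dF; exact: is_cvg_cst.
  - by move=> x; apply: derivableM.
  - by apply: gt0_cvgMrNy => //; exact: cvg_id.
  - by apply: gt0_cvgMry => //; exact: cvg_id.
  - exact: continuous_gauss_fun.
  - exact: gauss_fun_ge0.
rewrite dF integralT_gauss.
under eq_integral => x _.
  rewrite (_ : _ x = k * gauss1 c x); last first.
    rewrite /gauss_fun /gauss1 /k !fctE/= mulrC; congr (_ * expR (- _)).
    by rewrite -mulrA exprMn sqr_sqrtr// pi_ge0.
  rewrite EFinM; over.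
rewrite ge0_integralZl//=; last 3 first.
- by apply/measurable_EFinP; exact: measurable_gauss1.
- by move=> x _; rewrite lee_fin gauss1_ge0.
- by rewrite lee_fin ltW.
have : (0 <= \int[mu]_x (gauss1 c x)%:E)%E.
  by apply: integral_ge0 => x _; rewrite lee_fin gauss1_ge0.
(* The integral is not yet known to be finite; the value +oo is excluded because its multiple by k
   would equal the square root of pi. *)
case: (\int[mu]_x (gauss1 c x)%:E)%E => [r _|_|//].
  rewrite -EFinM => -[] h; congr EFin.
  apply: (@mulfI _ k); first by rewrite gt_eqF.
  by rewrite -h /k mulfK// gt_eqF.
by rewrite mulry gtr0_sg// mul1e.
Qed.

Lemma integrable_gauss1 c : 0 < c -> mu.-integrable setT (EFin \o gauss1 c).
Proof.
move=> c0; apply/integrableP; split.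
  by apply/measurable_EFinP; exact: measurable_gauss1.
under eq_integral do rewrite gee0_abs ?lee_fin ?gauss1_ge0//.
by rewrite integral_gauss1// ltry.
Qed.

Lemma gauss1_sqrt2 c x : gauss1 c x = gauss1 (c / Num.sqrt 2) x ^+ 2.
Proof.
rewrite /gauss1 -expRM_natl; congr expR.
by rewrite mulrN mulrCA -mulrAC exprMn [in RHS]exprMn exprVn sqr_sqrtr//; field.
Qed.

(** Half of the exponent absorbs the factor |x|: for y = c |x| / sqrt 2, one has y <= 1 + pi y^2 <=
    exp (pi y^2). *)
Lemma norm_gauss1_le c x : 0 < c ->
  `|x| * gauss1 c x <= Num.sqrt 2 / c * gauss1 (c / Num.sqrt 2) x.
Proof.
move=> c0; have s0 : 0 < Num.sqrt 2 :> R by rewrite sqrtr_gt0.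
rewrite gauss1_sqrt2 expr2 mulrA ler_wpM2r ?gauss1_ge0//.
set k := c / _; have k0 : 0 < k by rewrite divr_gt0.
have -> : Num.sqrt 2 / c = k^-1 by rewrite invf_div.
rewrite -ler_pdivlMr ?expR_gt0// /gauss1 expRN invrK.
rewrite mulrC ler_pdivlMr//.
apply: le_trans (expR_ge1Dx _).
have : 0 <= (k * `|x| - 1) ^+ 2 by rewrite sqr_ge0.
have -> : (k * x) ^+ 2 = (k * `|x|) ^+ 2 by rewrite !exprMn real_normK// num_real.
have := pi_ge2 R; nra.
Qed.

End gaussian1.

Lemma integrable_scale (R : realType) d (T : measurableType d)
    (m : {measure set T -> \bar R}) (k : R) (f : T -> R) :
  m.-integrable setT (EFin \o f) ->
  m.-integrable setT (EFin \o (fun x => k * f x)).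
Proof.
by move=> intf; rewrite /comp; under eq_fun do rewrite EFinM; exact: integrableZl.
Qed.

Lemma integrable_mul_le1 (R : realType) d (T : measurableType d)
    (m : {measure set T -> \bar R}) (f g : T -> R) :
  m.-integrable setT (EFin \o f) -> measurable_fun setT g ->
  (forall x, `|g x| <= 1) -> m.-integrable setT (EFin \o (fun x => f x * g x)).
Proof.
move=> intf mg g1; apply: le_integrable (intf) => //.
  apply/measurable_EFinP/measurable_funM => //.
  by have /integrableP[/measurable_EFinP] := intf.
by move=> x _; rewrite lee_fin normrM ler_piMr.
Qed.

(** * Fourier transform of a Gaussian on the line *)

Section fourier1.
Context {R : realType}.
Implicit Types c x xi th : R.
Local Notation mu := (@lebesgue_measure R).

Lemma continuous_cos_affine (k th : R) : continuous (fun x => cos (k * x + th)).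
Proof.
move=> x; apply: continuous_comp; last exact: continuous_cos.
by apply: cvgD; [apply: cvgM; [exact: cvg_cst|exact: cvg_id]|exact: cvg_cst].
Qed.

Lemma measurable_cos_affine (k th : R) :
  measurable_fun setT (fun x : R => cos (k * x + th)).
Proof.
by apply: continuous_measurable_fun; exact: continuous_cos_affine.
Qed.

Lemma continuous_sin_affine (k th : R) : continuous (fun x => sin (k * x + th)).
Proof.
move=> x; apply: continuous_comp; last exact: continuous_sin.
by apply: cvgD; [apply: cvgM; [exact: cvg_cst|exact: cvg_id]|exact: cvg_cst].
Qed.

Lemma measurable_sin_affine (k th : R) :
  measurable_fun setT (fun x : R => sin (k * x + th)).
Proof.
by apply: continuous_measurable_fun; exact: continuous_sin_affine.
Qed.

Lemma integrable_id_gauss1 c : 0 < c ->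
  mu.-integrable setT (EFin \o (fun x => x * gauss1 c x)).
Proof.
move=> c0; have s0 : 0 < Num.sqrt 2 :> R by rewrite sqrtr_gt0.
apply: (@le_integrable _ _ _ mu setT _ _
    (fun x => (Num.sqrt 2 / c * gauss1 (c / Num.sqrt 2) x)%:E)) => //.
- apply/measurable_EFinP; apply: measurable_funM => //.
  exact: measurable_gauss1.
- move=> x _; rewrite !abse_EFin lee_fin normrM (ger0_norm (gauss1_ge0 _ _)).
  by apply: le_trans (norm_gauss1_le _ c0) _; exact: ler_norm.
- by apply: integrable_scale; apply: integrable_gauss1; rewrite divr_gt0.
Qed.

(** The fundamental theorem of calculus on growing symmetric intervals, followed by dominated
    convergence with bound |h'|. *)
Lemma Rintegral_derive_eq0 (h h' : R -> R) :
  (forall x : R, is_derive x 1 h (h' x)) -> continuous h' ->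
  mu.-integrable setT (EFin \o h') ->
  h x @[x --> +oo] --> (0 : R) -> h x @[x --> -oo] --> (0 : R) ->
  \int[mu]_x h' x = 0.
Proof.
move=> dh ch' ih' hy hNy.
(* The shift to n + 1 keeps the interval nondegenerate at n = 0, as the fundamental theorem
   requires. *)
pose I n := `[- n.+1%:R, n.+1%:R]%classic : set R.
have mh' := measurable_int mu ih'.
have cvgI : (\int[mu]_(x in I n) (h' x)%:E)%E @[n --> \oo] -->
    (\int[mu]_x (h' x)%:E)%E.
  under eq_fun do rewrite integral_mkcond.
  apply: (@dominated_cvg _ _ _ mu setT _ _ _ (fun x => `|(h' x)%:E|)%E) => //.
  - move=> n; apply/(measurable_restrictT _ _).1 => //.
    exact: measurable_itv.
    exact: (measurable_funTS (mh')).
  - move=> x _; apply: cvg_near_cst; near=> n.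
    rewrite patchE ifT// inE /I/= in_itv/= -ler_norml.
    have : `|x| <= n%:R by near: n; exact: nbhs_infty_ger.
    by move=> /le_trans; apply; rewrite ler_nat.
  - exact: integrable_abse.
  - move=> n x _; rewrite patchE; case: ifPn => // _.
    by rewrite abse0.
have IE n : (\int[mu]_(x in I n) (h' x)%:E)%E = (h n.+1%:R - h (- n.+1%:R))%:E.
  rewrite EFinB; apply: continuous_FTC2 => //.
  - by rewrite gtrN.
  - exact: continuous_subspaceT.
  - have ch : continuous h.
      move=> x; apply: differentiable_continuous.
      by apply/derivable1_diffP; have [] := dh x.
    split.
    + by move=> x _; have [] := dh x.
    + exact: cvg_at_right_filter (ch _).
    + exact: cvg_at_left_filter (ch _).
  - by move=> x _; rewrite derive1E; have [_ ->] := dh x.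
have cvg0 : (h n.+1%:R - h (- n.+1%:R)) @[n --> \oo] --> (0 : R).
  rewrite -[X in _ --> X](subrr 0); apply: cvgB.
    apply: (cvg_comp (fun n : nat => n.+1%:R : R) h) hy.
    have := @cvgr_idn R; rewrite -(cvg_shiftS (fun n : nat => n%:R : R)); exact.
  apply: (cvg_comp (fun n : nat => - n.+1%:R : R) h) hNy.
  apply/cvgNrNy; have := @cvgr_idn R.
  by rewrite -(cvg_shiftS (fun n : nat => n%:R : R)).
move: cvgI; under eq_fun do rewrite IE.
rewrite -[X in _ --> X]fineK; last exact: integrable_fin_num.
move=> /fine_cvg; rewrite /comp/= => H.
rewrite /Rintegral; exact: (cvg_unique _ H cvg0).
Unshelve. all: by end_near. Qed.

Lemma is_derive_expR_sqr k (z : R) :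
  is_derive z 1 (fun z => expR (pi * (k * z) ^+ 2))
    (2 * pi * k ^+ 2 * z * expR (pi * (k * z) ^+ 2)).
Proof.
have d1 : is_derive z 1 (fun z => k * z) k by apply: is_derive_eq; rewrite scaler1.
have d3 := is_derive1_comp (is_derive_expR _) (is_deriveZ pi (is_deriveM d1 d1)).
rewrite (_ : (fun z => _) =
    expR \o (pi \*: ((fun z => k * z) * (fun z => k * z)))).
  apply: (@is_derive_eq _ _ _ _ _ _ _ _ d3).
  by rewrite /= /GRing.scale/= !fctE /GRing.scale/=; ring.
by apply/funext => y.
Qed.

Lemma is_derive_sin_affine k th (x : R) :
  is_derive x 1 (fun x => sin (k * x + th)) (k * cos (k * x + th)).
Proof.
have dl : is_derive x 1 (fun x => k * x + th) k.
  by apply: is_derive_eq; rewrite scaler1 addr0.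
by apply: is_derive_eq; rewrite mulrC.
Qed.

(** This is the integration by parts behind the Gaussian transform: the integral of this derivative
    vanishes, which ties the sine transform of x [gauss1] to the cosine transform of [gauss1]. *)
Lemma is_derive_gauss1_sin c z th (x : R) :
  is_derive x 1 (fun x => gauss1 c x * sin (2 * pi * z * x + th))
    (- (2 * pi * c ^+ 2) * (x * gauss1 c x * sin (2 * pi * z * x + th)) +
     2 * pi * z * (gauss1 c x * cos (2 * pi * z * x + th))).
Proof.
have ds := is_derive_sin_affine (2 * pi * z) th x.
by apply: is_derive_eq; rewrite /GRing.scale/=; ring.
Qed.

Lemma cvgy_gauss1 c : 0 < c -> gauss1 c x @[x --> +oo] --> (0 : R).
Proof.
move=> c0; have -> : gauss1 c = gauss_fun \o (fun x => Num.sqrt pi * c * x).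
  apply/funext => x; rewrite /gauss1 /gauss_fun/=; congr (expR (- _)).
  by rewrite -mulrA [in RHS]exprMn sqr_sqrtr// pi_ge0.
apply: cvg_comp cvg_gauss_fun; apply: gt0_cvgMry; last exact: cvg_id.
by rewrite mulr_gt0// sqrtr_gt0 pi_gt0.
Qed.

Lemma cvgNy_gauss1 c : 0 < c -> gauss1 c x @[x --> -oo] --> (0 : R).
Proof.
move=> c0; apply/cvgNy_compNP.
have -> : gauss1 c \o -%R = gauss1 c.
  by apply/funext => x; rewrite /gauss1/= mulrN sqrrN.
exact: cvgy_gauss1.
Qed.

Lemma squeeze0_gauss1 c (F : set_system R) {FF : Filter F} (h : R -> R) :
  (forall x, `|h x| <= gauss1 c x) -> gauss1 c x @[x --> F] --> (0 : R) ->
  h x @[x --> F] --> (0 : R).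
Proof.
move=> hle g0; apply: norm_cvg0.
apply: (squeeze_cvgr _ (cvg_cst 0) g0).
by apply: nearW => x; rewrite normr_ge0 hle.
Qed.

(* F xi, the integral, satisfies F' = - (2 pi xi / c^2) F by integration by
   parts, so that F xi * exp (pi (xi / c)^2) is constant. The phase th covers
   the cosine and the sine transforms at once. *)
Lemma fourier_gauss1 c xi th : 0 < c ->
  \int[mu]_x (gauss1 c x * cos (2 * pi * xi * x + th)) =
  c^-1 * (cos th * gauss1 c^-1 xi).
Proof.
move=> c0.
have c_neq0 : c != 0 by rewrite gt_eqF.
pose f (z x : R) := gauss1 c x * cos (2 * pi * z * x + th).
pose S z := \int[mu]_x (x * gauss1 c x * sin (2 * pi * z * x + th)).
pose F z := \int[mu]_x f z x.
have intf z : mu.-integrable setT (EFin \o f z).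
  apply: integrable_mul_le1; first exact: integrable_gauss1.
    exact: measurable_cos_affine.
  by move=> x; rewrite ler_norml cos_geN1 cos_le1.
have intS z : mu.-integrable setT
    (EFin \o (fun x => x * gauss1 c x * sin (2 * pi * z * x + th))).
  apply: integrable_mul_le1; first exact: integrable_id_gauss1.
    exact: measurable_sin_affine.
  by move=> x; rewrite ler_norml sin_geN1 sin_le1.
have df (z x : R) : is_derive z 1 (f ^~ x)
    (- (2 * pi) * (x * gauss1 c x * sin (2 * pi * z * x + th))).
  apply: is_derive_eq; rewrite !scaler1 /GRing.scale/=; ring.
have dF (z : R) : is_derive z 1 F (- (2 * pi) * S z).
  (* The dominating function for differentiation under the integral; it bounds the derivative at
     every z', so any interval around z does. *)
  pose G (x : R) := 2 * pi * (`|x * gauss1 c x|).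
  have zI : z \in `]z - 1, z + 1[ by rewrite in_itv/= ltrBlDr ltrDl ltr01.
  have G0 x : 0 <= G x by rewrite !mulr_ge0 ?pi_ge0.
  have intG : mu.-integrable setT (EFin \o G).
    apply: integrable_scale.
    exact: (integrable_abse (integrable_id_gauss1 c0)).
  have GE (z' x : R) : partial1of2 f z' x =
      - (2 * pi) * (x * gauss1 c x * sin (2 * pi * z' * x + th)).
    by rewrite partial1of2E; have [_ ->] := df z' x.
  have Gub (z' x : R) : `|partial1of2 f z' x| <= G x.
    rewrite GE normrM normrN (@ger0_norm _ (2 * pi)) ?mulr_ge0 ?pi_ge0//.
    rewrite ler_wpM2l ?mulr_ge0 ?pi_ge0// normrM ler_piMr//.
    by rewrite ler_norml sin_geN1 sin_le1.
  have dfz (z' x : R) : derivable (f ^~ x) z' 1 by have [] := df z' x.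
  apply: DeriveDef.
    exact: (@derivable_under_integral _ _ _ mu f setT _ z (z - 1) (z + 1) _
      (fun z' _ => intf z') (fun z' x _ _ => dfz z' x) G G0 intG
      (fun z' x _ _ => Gub z' x)).
  rewrite -derive1E (@differentiation_under_integral _ _ _ mu f setT _ z
    (z - 1) (z + 1) _ (fun z' _ => intf z') (fun z' x _ _ => dfz z' x) G G0
    intG (fun z' x _ _ => Gub z' x))//.
  under eq_Rintegral do rewrite GE.
  by rewrite RintegralZl.
(* S and F are the integrals of the two terms of h', whose total integral is zero. *)
have SE z : c ^+ 2 * S z = z * F z.
  pose h x := gauss1 c x * sin (2 * pi * z * x + th).
  pose h' x := (- (2 * pi * c ^+ 2)) * (x * gauss1 c x * sin (2 * pi * z * x + th))
    + 2 * pi * z * f z x.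
  have dh (x : R) : is_derive x 1 h (h' x).
    exact: is_derive_gauss1_sin.
  have ih' : mu.-integrable setT (EFin \o h').
    rewrite /comp; under eq_fun do rewrite EFinD.
    apply: integrableD => //; first exact: (integrable_scale _ (intS z)).
    exact: (integrable_scale _ (intf z)).
  have ch' : continuous h'.
    move=> x; apply: cvgD; (apply: cvgM; first exact: cvg_cst).
      apply: cvgM; last exact: continuous_sin_affine.
      by apply: cvgM; [exact: cvg_id|exact: continuous_gauss1].
    by apply: cvgM; [exact: continuous_gauss1|exact: continuous_cos_affine].
  have hle x : `|h x| <= gauss1 c x.
    rewrite normrM (ger0_norm (gauss1_ge0 _ _)) ler_piMr ?gauss1_ge0//.
    by rewrite ler_norml sin_geN1 sin_le1.
  have hy : h x @[x --> +oo] --> (0 : R).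
    exact: (squeeze0_gauss1 hle (cvgy_gauss1 c0)).
  have hNy : h x @[x --> -oo] --> (0 : R).
    exact: (squeeze0_gauss1 hle (cvgNy_gauss1 c0)).
  have := Rintegral_derive_eq0 dh ch' ih' hy hNy.
  rewrite /h' RintegralD//; last 2 first.
  - exact: (integrable_scale _ (intS z)).
  - exact: (integrable_scale _ (intf z)).
  rewrite !RintegralZl// -/(F z) -/(S z) => /eqP.
  rewrite mulNr addrC subr_eq0 => /eqP h2.
  apply: (@mulfI _ (2 * pi)); first by rewrite mulf_neq0// gt_eqF// pi_gt0.
  by rewrite [LHS]mulrA -h2 -mulrA.
have dE (z : R) : is_derive z 1 (F * (fun z => expR (pi * (c^-1 * z) ^+ 2))) 0.
  have -> : 0 = F z *: (2 * pi * c^-1 ^+ 2 * z * expR (pi * (c^-1 * z) ^+ 2)) +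
      expR (pi * (c^-1 * z) ^+ 2) *: (- (2 * pi) * S z).
    have -> : S z = c^-1 ^+ 2 * (z * F z) by rewrite -SE exprVn mulKf// expf_neq0.
    by rewrite /GRing.scale/=; ring.
  exact: (is_deriveM (dF z) (is_derive_expR_sqr c^-1 z)).
have := is_derive_0_is_cst xi 0 dE.
rewrite !fctE mulr0 expr0n/= mulr0 expR0 mulr1 => FE.
have F0 : F 0 = cos th * c^-1.
  rewrite /F /f; under eq_Rintegral do rewrite mulr0 mul0r add0r mulrC.
  rewrite RintegralZl//; last exact: integrable_gauss1.
  by rewrite /Rintegral integral_gauss1.
change (F xi = c^-1 * (cos th * gauss1 c^-1 xi)).
rewrite mulrA [c^-1 * _]mulrC -F0 -FE /gauss1 expRN mulfK//.
by rewrite gt_eqF// expR_gt0.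
Qed.
End fourier1.

(** * Integration over row vectors *)

Section integral_row.
Context {R : realType}.
Local Notation mu := (@lebesgue_measure R).
Local Notation rmu := (@lebesgue_row R).

Lemma integral_row0 (f : 'rV[R]_0 -> \bar R) :
  measurable_fun setT f -> (\int[rmu 0]_v f v)%E = f 0.
Proof. by move=> mf; rewrite integral_dirac// diracT mul1e. Qed.

Lemma ge0_integral_rowS n (f : 'rV[R]_n.+1 -> \bar R) :
  (forall v, 0 <= f v)%E -> measurable_fun setT f ->
  (\int[rmu n.+1]_v f v = \int[rmu n]_v \int[mu]_x f (row_cons (x, v)))%E.
Proof.
move=> f0 mf; have mc := @measurable_row_cons R n.
transitivity (\int[pushforward (mu \x rmu n) (@row_cons R n)]_v f v)%E => //.
rewrite (ge0_integral_pushforward mc)//= preimage_setT.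
rewrite (fubini_tonelli2 (f \o @row_cons R n))//.
  exact: measurableT_comp.
by move=> x; exact: f0.
Qed.

Lemma measurable_integral_row_cons n (f : 'rV[R]_n.+1 -> \bar R) :
  (forall v, 0 <= f v)%E -> measurable_fun setT f ->
  measurable_fun setT (fun v => \int[mu]_x f (row_cons (x, v)))%E.
Proof.
move=> f0 mf; apply: (@measurable_fun_fubini_tonelli_G _ _ _ _ _ _
  (f \o @row_cons R n)) => //.
  by apply: measurableT_comp => //; exact: measurable_row_cons.
by move=> x; exact: f0.
Qed.

Lemma row_cons0 n (x : R) (v : 'rV[R]_n) : row_cons (x, v) 0 0 = x.
Proof. by have /(congr1 fst) := row_consK (x, v). Qed.

Lemma row_consS n (x : R) (v : 'rV[R]_n) i :
  row_cons (x, v) 0 (lift ord0 i) = v 0 i.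
Proof.
by have /(congr1 (fun q : _ * 'rV[R]_n => q.2 ord0 i)) := row_consK (x, v);
  rewrite /= mxE.
Qed.

Lemma row_mx_row_cons m n (x : R) (u : 'rV[R]_m) (w : 'rV[R]_n) :
  row_cons (x, row_mx u w) = row_mx (row_cons (x, u)) w.
Proof. by rewrite /row_cons/= row_mxA castmx_id. Qed.

Lemma measurable_row_mxl m n (w : 'rV[R]_n) :
  measurable_fun setT (fun u : 'rV[measurableTypeR R]_m => row_mx u w).
Proof.
apply: measurable_fun_row => i; case: (split_ordP i) => j ->.
  under eq_fun do rewrite row_mxEl; exact: measurable_coord.
under eq_fun do rewrite row_mxEr; exact: measurable_cst.
Qed.

(** The measure is built one coordinate at a time, hence an induction on m that peels off the first
    coordinate of the left block. *)
Lemma ge0_integral_row_mx m n (f : 'rV[R]_(m + n) -> \bar R) :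
  (forall v, 0 <= f v)%E -> measurable_fun setT f ->
  (\int[rmu (m + n)]_v f v = \int[rmu n]_w \int[rmu m]_u f (row_mx u w))%E.
Proof.
elim: m f => [|m IH] f f0 mf.
  apply: eq_integral => w _; rewrite integral_row0; last first.
    by apply: measurableT_comp => //; exact: measurable_row_mxl.
  congr f; apply/rowP => i; case: (@split_ordP 0 n i) => j ->; first by case: j.
  rewrite (row_mxEr (0 : 'rV[R]_0) w) /=; congr (fun_of_matrix w _ _).
  exact: val_inj.
rewrite [LHS]ge0_integral_rowS// IH; last 2 first.
- by move=> v; apply: integral_ge0.
- exact: measurable_integral_row_cons.
apply: eq_integral => w _; rewrite ge0_integral_rowS//; last first.
  by apply: measurableT_comp => //; exact: measurable_row_mxl.
apply: eq_integral => u _; apply: eq_integral => x _.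
by rewrite row_mx_row_cons.
Qed.

End integral_row.

(** * Gaussian integrals in several variables *)

Section gauss_row.
Context {R : realType}.
Local Notation mu := (@lebesgue_measure R).
Local Notation rmu := (@lebesgue_row R).

Definition gauss n (c : 'I_n -> R) (v : 'rV[R]_n) : R :=
  \prod_(i < n) gauss1 (c i) (v 0 i).

Lemma gauss_ge0 n (c : 'I_n -> R) v : 0 <= gauss c v.
Proof. by apply: prodr_ge0 => i _; exact: gauss1_ge0. Qed.

Lemma gauss_le1 n (c : 'I_n -> R) v : gauss c v <= 1.
Proof. by apply: prodr_ile1 => i _; rewrite gauss1_ge0 gauss1_le1. Qed.

Lemma gauss_row_cons n (c : 'I_n.+1 -> R) x v :
  gauss c (row_cons (x, v)) =
  gauss1 (c ord0) x * gauss (fun i => c (lift ord0 i)) v.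
Proof.
rewrite /gauss big_ord_recl row_cons0; congr (_ * _).
by apply: eq_bigr => i _; rewrite row_consS.
Qed.

Lemma gauss_row_mx m n (c : 'I_(m + n) -> R) u w :
  gauss c (row_mx u w) =
  gauss (fun i => c (lshift n i)) u * gauss (fun i => c (rshift m i)) w.
Proof.
rewrite /gauss big_split_ord; congr (_ * _).
  by apply: eq_bigr => i _; rewrite row_mxEl.
by apply: eq_bigr => i _; rewrite row_mxEr.
Qed.

Lemma measurable_gauss n (c : 'I_n -> R) : measurable_fun setT (gauss c).
Proof.
apply: measurable_prod => i _; apply: measurableT_comp.
  exact: measurable_gauss1.
exact: (@measurable_coord _ (measurableTypeR R)).
Qed.

Lemma measurable_dot n (xi : 'rV[R]_n) : measurable_fun setT (dot xi).
Proof.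
apply: measurable_sum => i; apply: measurable_funM => //.
exact: (@measurable_coord _ (measurableTypeR R)).
Qed.

Lemma dot_row_cons n (xi : 'rV[R]_n.+1) x v :
  dot xi (row_cons (x, v)) =
  xi 0 ord0 * x + dot (\row_i xi 0 (lift ord0 i)) v.
Proof.
rewrite /dot big_ord_recl row_cons0; congr (_ + _).
by apply: eq_bigr => i _; rewrite row_consS mxE.
Qed.

Lemma dot_row_mx m n (xi : 'rV[R]_m) (eta : 'rV[R]_n) u w :
  dot (row_mx xi eta) (row_mx u w) = dot xi u + dot eta w.
Proof.
rewrite /dot big_split_ord; congr (_ + _).
  by apply: eq_bigr => i _; rewrite !row_mxEl.
by apply: eq_bigr => i _; rewrite !row_mxEr.
Qed.

(** The shape al + be cos is stable under integration in one variable: al is kept and be is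
    multiplied by a Gaussian value, up to the common factor [c^-1]. This makes an induction on the
    dimension possible. *)
Lemma integral_gauss1_cos (c xi th al be : R) : 0 < c -> `|be| <= al ->
  (\int[mu]_x ((al + be * cos (2 * pi * xi * x + th)) * gauss1 c x)%:E =
   (c^-1 * (al + be * (cos th * gauss1 c^-1 xi)))%:E)%E.
Proof.
move=> c0 beal.
have intc : mu.-integrable setT
    (EFin \o (fun x => gauss1 c x * cos (2 * pi * xi * x + th))).
  apply: integrable_mul_le1; first exact: integrable_gauss1.
    exact: measurable_cos_affine.
  by move=> x; rewrite ler_norml cos_geN1 cos_le1.
transitivity (\int[mu]_x ((al * gauss1 c x)%:E +
    (be * (gauss1 c x * cos (2 * pi * xi * x + th)))%:E))%E.
  by apply: eq_integral => x _; rewrite -EFinD; congr EFin; ring.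
rewrite integralD//; last 2 first.
- by apply: integrable_scale; exact: integrable_gauss1.
- exact: integrable_scale.
have EI (f : R -> R) k : mu.-integrable setT (EFin \o f) ->
    (\int[mu]_x (k * f x)%:E = (k * \int[mu]_x f x)%:E)%E.
  move=> intf; rewrite -RintegralZl// /Rintegral fineK//.
  by apply: integrable_fin_num => //; exact: integrable_scale.
rewrite !EI//; last exact: integrable_gauss1.
rewrite fourier_gauss1// -EFinD; congr EFin.
by rewrite {1}/Rintegral integral_gauss1//=; ring.
Qed.

Lemma measurable_cos_dot n (xi : 'rV[R]_n) th :
  measurable_fun setT (fun v => cos (2 * pi * dot xi v + th)).
Proof.
apply: measurableT_comp.
  by apply: continuous_measurable_fun; exact: continuous_cos.
apply: measurable_funD => //; apply: measurable_funM => //.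
exact: measurable_dot.
Qed.

Lemma measurable_cos_gauss n (c : 'I_n -> R) xi (th al be : R) :
  measurable_fun setT
    (fun v => (al + be * cos (2 * pi * dot xi v + th)) * gauss c v).
Proof.
apply: measurable_funM; last exact: measurable_gauss.
apply: measurable_funD => //; apply: measurable_funM => //.
exact: measurable_cos_dot.
Qed.

Lemma cos_affine_ge0 (al be t : R) : `|be| <= al -> 0 <= al + be * cos t.
Proof.
move=> beal; rewrite -lerBlDl sub0r.
have : `|be * cos t| <= `|be|.
  by rewrite normrM ler_piMr// ler_norml cos_geN1 cos_le1.
by move=> /le_trans/(_ beal); rewrite ler_norml => /andP[].
Qed.

(* The hypothesis [`|be| <= al] makes the integrand nonnegative, so that
   Tonelli's theorem suffices. *)
Lemma integral_gauss_cos n (c : 'I_n -> R) xi (th al be : R) :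
  (forall i, 0 < c i) -> `|be| <= al ->
  (\int[rmu n]_v ((al + be * cos (2 * pi * dot xi v + th)) * gauss c v)%:E =
   ((\prod_i (c i)^-1) *
     (al + be * (cos th * gauss (fun i => (c i)^-1) xi)))%:E)%E.
Proof.
elim: n c xi th al be => [|n IH] c xi th al be c0 beal.
  rewrite integral_row0; last first.
    by apply/measurable_EFinP; exact: measurable_cos_gauss.
  by rewrite /dot /gauss !big_ord0 mulr0 add0r !mulr1 mul1r.
rewrite ge0_integral_rowS; last 2 first.
- by move=> v; rewrite lee_fin mulr_ge0 ?gauss_ge0 ?cos_affine_ge0.
- by apply/measurable_EFinP; exact: measurable_cos_gauss.
pose xi' := \row_i xi 0 (lift ord0 i) : 'rV[R]_n.
pose c' i := c (lift ord0 i).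
pose g := gauss1 (c ord0)^-1 (xi 0 ord0).
transitivity (\int[rmu n]_v ((c ord0)^-1%:E * ((al + be * g *
    cos (2 * pi * dot xi' v + th)) * gauss c' v)%:E))%E.
  apply: eq_integral => v _.
  (* For fixed v, the share of v in the scalar product is moved into the phase. *)
  transitivity (\int[mu]_x ((gauss c' v)%:E *
    ((al + be * cos (2 * pi * xi 0 ord0 * x + (2 * pi * dot xi' v + th))) *
     gauss1 (c ord0) x)%:E))%E.
    apply: eq_integral => x _; rewrite -EFinM; congr EFin.
    rewrite gauss_row_cons dot_row_cons -/xi' -/c'.
    by rewrite [2 * pi * (_ + _)]mulrDr [2 * pi * (_ * _)]mulrA -addrA; ring.
  rewrite ge0_integralZl//; last 3 first.
  - apply/measurable_EFinP; apply: measurable_funM; last exact: measurable_gauss1.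
    apply: measurable_funD => //; apply: measurable_funM => //.
    exact: measurable_cos_affine.
  - move=> x _; rewrite lee_fin mulr_ge0 ?gauss1_ge0 ?cos_affine_ge0//.
  - by rewrite lee_fin gauss_ge0.
  rewrite integral_gauss1_cos// -!EFinM; congr EFin; rewrite -/g; ring.
(* The amplitude condition for the induction hypothesis: the new amplitude be g is smaller, since 0
   <= g <= 1. *)
have gal : `|be * g| <= al.
  rewrite normrM (le_trans _ beal)// ler_piMr//.
  by rewrite ger0_norm ?gauss1_ge0 ?gauss1_le1.
rewrite ge0_integralZl//; last 3 first.
- by apply/measurable_EFinP; exact: measurable_cos_gauss.
- by move=> v _; rewrite lee_fin mulr_ge0 ?gauss_ge0 ?cos_affine_ge0.
- by rewrite lee_fin invr_ge0 ltW.
have c'0 i : 0 < c' i by exact: c0.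
rewrite IH// -EFinM; congr EFin.
rewrite big_ord_recl /gauss big_ord_recl -!mulrA; congr (_ * (_ * (_ + _ * _))).
rewrite mulrCA; congr (_ * (_ * _)); apply: eq_bigr => i _.
by rewrite mxE.
Qed.

End gauss_row.

(** * Gaussians are Schwartz functions *)

Section gauss_schwartz.
Context {R : realType} {n : nat}.
Implicit Types (f g p q : 'rV[R]_n -> R) (c : 'I_n -> R) (i : 'I_n).

(** Polynomial functions as an inductive closure, so that differentiability, stability under
    derivation and bounds all follow by structural induction. *)
Inductive polyfun : ('rV[R]_n -> R) -> Prop :=
| polyfun_cst (k : R) : polyfun (fun=> k)
| polyfun_coord i : polyfun (fun v => v 0 i)
| polyfunD f g : polyfun f -> polyfun g -> polyfun (fun v => f v + g v)
| polyfunM f g : polyfun f -> polyfun g -> polyfun (fun v => f v * g v).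

Lemma polyfun_differentiable f v : polyfun f -> differentiable f v.
Proof.
elim=> {f} [k|i|f g _ df _ dg|f g _ df _ dg].
- exact: differentiable_cst.
- exact: differentiable_coord.
- exact: differentiableD.
- exact: differentiableM.
Qed.

Lemma polyfun_partial f i : polyfun f -> polyfun (partial i f).
Proof.
elim=> {f} [k|j|f g pf df pg dg|f g pf df pg dg].
- rewrite (_ : partial i _ = fun=> 0); first exact: polyfun_cst.
  by apply/funext => v; rewrite /partial derive_cst.
- rewrite (_ : partial i _ = fun=> (delta_mx 0 i : 'rV[R]_n) 0 j).
    exact: polyfun_cst.
  apply/funext => v; apply/cvg_lim => //; apply: cvg_near_cst.
  near=> h; rewrite /= /shift/=.
  rewrite [X in _ *: X](_ : _ = h * (delta_mx 0 i : 'rV[R]_n) 0 j).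
    rewrite /GRing.scale/= mulKf//; near: h; exact: nbhs_dnbhs_neq.
  by rewrite !mxE; ring.
- rewrite (_ : partial i _ = fun v => partial i f v + partial i g v).
    exact: polyfunD.
  apply/funext => v; rewrite /partial deriveD//; apply: diff_derivable;
    exact: polyfun_differentiable.
- rewrite (_ : partial i _ = fun v => f v * partial i g v + g v * partial i f v).
    by apply: polyfunD; apply: polyfunM.
  apply/funext => v; rewrite /partial deriveM//; apply: diff_derivable;
    exact: polyfun_differentiable.
Unshelve. all: by end_near. Qed.

Lemma polyfun_sum I (r : seq I) (F : I -> 'rV[R]_n -> R) :
  (forall j, polyfun (F j)) -> polyfun (fun v => \sum_(j <- r) F j v).
Proof.
move=> pF; elim: r => [|j r IH].
  by under eq_fun do rewrite big_nil; exact: polyfun_cst.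
by under eq_fun do rewrite big_cons; exact: polyfunD.
Qed.

Lemma polyfun_prod I (r : seq I) (F : I -> 'rV[R]_n -> R) :
  (forall j, polyfun (F j)) -> polyfun (fun v => \prod_(j <- r) F j v).
Proof.
move=> pF; elim: r => [|j r IH].
  by under eq_fun do rewrite big_nil; exact: polyfun_cst.
by under eq_fun do rewrite big_cons; exact: polyfunM.
Qed.

Lemma polyfunX f k : polyfun f -> polyfun (fun v => f v ^+ k).
Proof.
move=> pf; elim: k => [|k IH].
  by under eq_fun do rewrite expr0; exact: polyfun_cst.
by under eq_fun do rewrite exprS; exact: polyfunM.
Qed.

(** As the exponential of a polynomial, the Gaussian reproduces itself up to a polynomial factor
    under every derivation. *)
Lemma gauss_expR c : exists2 q, polyfun q & gauss c = expR \o q.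
Proof.
exists (fun v => \sum_(i < n) (- pi) * ((c i * v 0 i) ^+ 2)).
  apply: polyfun_sum => i; apply: polyfunM; first exact: polyfun_cst.
  apply: polyfunX; apply: polyfunM; first exact: polyfun_cst.
  exact: polyfun_coord.
apply/funext => v; rewrite /gauss /= expR_sum.
by apply: eq_bigr => i _; rewrite /gauss1 mulNr.
Qed.

Lemma differentiable_expR_comp q v : differentiable q v ->
  differentiable (expR \o q) v.
Proof.
move=> dq; apply: differentiable_comp => //.
by apply/derivable1_diffP; exact: derivable_expR.
Qed.

Lemma partial_expR_comp q i v : differentiable q v ->
  partial i (expR \o q) v = partial i q v * expR (q v).
Proof.
move=> dq; have dE : differentiable expR (q v).
  by apply/derivable1_diffP; exact: derivable_expR.
rewrite /partial deriveE; last exact: differentiable_expR_comp.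
have dcomp := diff_comp dq dE.
rewrite [LHS](congr1 (fun F => F (delta_mx 0 i)) dcomp) /=.
rewrite [LHS](congr1 (fun F => F ('d q v (delta_mx 0 i))) (diff1E dE)).
rewrite (deriveE _ dq) derive1E.
have [_ ->] := is_derive_expR (q v).
by [].
Qed.

(** One derivation turns p exp q into (p_i + p q_i) exp q, where the index denotes the partial
    derivative; the first factor is again polynomial. *)
Lemma partials_polyfun_gauss c p s : polyfun p ->
  exists2 p', polyfun p' &
    partials s (fun v => p v * gauss c v) = (fun v => p' v * gauss c v).
Proof.
have [q pq ->] := gauss_expR c.
move=> pp; elim: s => [|i s [p' pp' IH]] /=; first by exists p.
exists (fun v => partial i p' v + p' v * partial i q v).
  by apply: polyfunD; [|apply: polyfunM => //]; exact: polyfun_partial.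
rewrite IH; apply/funext => v.
have dq := polyfun_differentiable v pq.
have dp := polyfun_differentiable v pp'.
have de := differentiable_expR_comp dq.
have ddp : derivable p' v (delta_mx 0 i) by exact: diff_derivable.
have dde : derivable (expR \o q) v (delta_mx 0 i) by exact: diff_derivable.
have := deriveM ddp dde.
rewrite {1}/partial => ->.
rewrite -[X in _ *: X + _]/(partial i (expR \o q) v) partial_expR_comp//.
by rewrite /GRing.scale/= /partial; ring.
Qed.

Lemma gauss_sqrt2 c v :
  gauss c v = gauss (fun i => c i / Num.sqrt 2) v ^+ 2.
Proof.
rewrite /gauss expr2 -big_split; apply: eq_bigr => i _ /=.
by rewrite gauss1_sqrt2 expr2.
Qed.

(* Products are dealt with by [gauss_sqrt2], which splits the Gaussian evenly
   between the factors; whence the quantification over [c]. *)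
Lemma polyfun_gauss_bounded p c : (forall i, 0 < c i) -> polyfun p ->
  exists M, forall v, `|p v * gauss c v| <= M.
Proof.
move=> + pp; elim: pp c => {p} [k|i|f g _ bf _ bg|f g _ bf _ bg] c c0.
- exists `|k| => v.
  by rewrite normrM (ger0_norm (gauss_ge0 _ _)) ler_piMr ?gauss_le1.
- exists (Num.sqrt 2 / c i) => v.
  rewrite normrM (ger0_norm (gauss_ge0 _ _)) /gauss (bigD1 i)//= mulrA.
  rewrite -[leRHS]mulr1 ler_pM//.
  + by rewrite mulr_ge0 ?gauss1_ge0.
  + by apply: prodr_ge0 => j _; exact: gauss1_ge0.
  + apply: (le_trans (norm_gauss1_le _ (c0 i))).
    by rewrite ler_piMr ?gauss1_le1// divr_ge0 ?ltW// sqrtr_gt0.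
  + by apply: prodr_ile1 => j _; rewrite gauss1_ge0 gauss1_le1.
- have [M1 h1] := bf c c0; have [M2 h2] := bg c c0.
  exists (M1 + M2) => v; rewrite mulrDl.
  by apply: (le_trans (ler_normD _ _)); exact: lerD.
- have c'0 i : 0 < c i / Num.sqrt 2 by rewrite divr_gt0// sqrtr_gt0.
  have [M1 h1] := bf _ c'0; have [M2 h2] := bg _ c'0.
  exists (M1 * M2) => v; rewrite gauss_sqrt2 expr2 mulrACA normrM.
  by rewrite ler_pM.
Qed.

Lemma real_schwartz_polyfun_gauss p c : (forall i, 0 < c i) -> polyfun p ->
  real_schwartz (fun v => p v * gauss c v).
Proof.
move=> c0 pp s; have [p' pp' ->] := partials_polyfun_gauss c s pp.
split=> [v|a].
  apply: differentiableM; first exact: polyfun_differentiable.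
  have [q pq ->] := gauss_expR c.
  by apply: differentiable_expR_comp; exact: polyfun_differentiable.
have pm : polyfun (fun v => monomial a v * p' v).
  apply: polyfunM => //; rewrite /monomial.
  by apply: polyfun_prod => i; apply: polyfunX; exact: polyfun_coord.
have [M hM] := polyfun_gauss_bounded c0 pm.
by exists M => v; rewrite mulrA.
Qed.

Lemma schwartz_gauss c : (forall i, 0 < c i) ->
  schwartz (fun v => (gauss c v)%:C%C).
Proof.
move=> c0; split => /=.
  rewrite (_ : (fun _ => _) = (fun v => 1 * gauss c v)).
    by apply: real_schwartz_polyfun_gauss => //; exact: polyfun_cst.
  by apply/funext => v; rewrite mul1r.
rewrite (_ : (fun _ => _) = (fun v => 0 * gauss c v)).
  by apply: real_schwartz_polyfun_gauss => //; exact: polyfun_cst.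
by apply/funext => v; rewrite mul0r.
Qed.

End gauss_schwartz.

(** * The value of the distribution on Gaussians *)

Section theta_gauss.
Context {R : realType}.
Local Notation mu := (@lebesgue_measure R).
Local Notation rmu := (@lebesgue_row R).

Lemma integral_gauss n (c : 'I_n -> R) : (forall i, 0 < c i) ->
  (\int[rmu n]_v (gauss c v)%:E = (\prod_i (c i)^-1)%:E)%E.
Proof.
move=> c0; have := @integral_gauss_cos R n c 0 0 1 0 c0.
rewrite normr0 ler01 => /(_ isT).
under eq_integral do rewrite mul0r addr0 mul1r.
by rewrite mul0r addr0 mulr1.
Qed.

Lemma integrable_gauss n (c : 'I_n -> R) : (forall i, 0 < c i) ->
  (rmu n).-integrable setT (EFin \o gauss c).
Proof.
move=> c0; apply/integrableP; split.
  by apply/measurable_EFinP; exact: measurable_gauss.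
under eq_integral do rewrite /= ger0_norm ?gauss_ge0//.
by rewrite integral_gauss// ltry.
Qed.

(** The case al = be = 1 of [integral_gauss_cos], from which the mass of the Gaussian, now known to
    be finite, is subtracted. *)
Lemma Rintegral_gauss_cos n (c : 'I_n -> R) xi th : (forall i, 0 < c i) ->
  \int[rmu n]_v (cos (2 * pi * dot xi v + th) * gauss c v) =
  (\prod_i (c i)^-1) * (cos th * gauss (fun i => (c i)^-1) xi).
Proof.
move=> c0; have intg := integrable_gauss c0.
have intc : (rmu n).-integrable setT
    (EFin \o (fun v => gauss c v * cos (2 * pi * dot xi v + th))).
  apply: integrable_mul_le1 => //; first exact: measurable_cos_dot.
  by move=> v; rewrite ler_norml cos_geN1 cos_le1.
have := @integral_gauss_cos R n c xi th 1 1 c0.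
rewrite normr1 lexx => /(_ isT) h.
have : \int[rmu n]_v (gauss c v + gauss c v * cos (2 * pi * dot xi v + th)) =
    \prod_i (c i)^-1 +
    (\prod_i (c i)^-1) * (cos th * gauss (fun i => (c i)^-1) xi).
  rewrite -{1}[\prod_i _]mulr1 -mulrDr -[cos th * _]mul1r.
  rewrite /Rintegral -[RHS]/(fine _%:E) -h; congr fine.
  by apply: eq_integral => v _; congr EFin; ring.
rewrite RintegralD//.
have -> : \int[rmu n]_v gauss c v = \prod_i (c i)^-1.
  by rewrite /Rintegral integral_gauss.
move=> /addrI <-.
by apply: eq_Rintegral => v _; rewrite mulrC.
Qed.

Definition pair_scale d (a b : R) (i : 'I_(d + d)) : R :=
  if fintype.split i is inl _ then a else b.

Lemma pair_scale_gt0 d a b : 0 < a -> 0 < b ->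
  forall i, 0 < @pair_scale d a b i.
Proof. by move=> a0 b0 i; rewrite /pair_scale; case: fintype.split. Qed.

Lemma gauss_pair_scale d a b (u w : 'rV[R]_d) :
  gauss (pair_scale a b) (row_mx u w) = gauss (fun=> a) u * gauss (fun=> b) w.
Proof.
rewrite gauss_row_mx; congr (_ * _); apply: eq_bigr => i _;
  rewrite /pair_scale.
  by rewrite (unsplitK (inl i)).
by rewrite (unsplitK (inr i)).
Qed.

Lemma prod_pair_scale d a b :
  \prod_i (@pair_scale d a b i)^-1 = (a^-1) ^+ d * (b^-1) ^+ d.
Proof.
rewrite big_split_ord; congr (_ * _).
  under eq_bigr => i _ do rewrite /pair_scale (unsplitK (inl i)).
  by rewrite prodr_const card_ord.
under eq_bigr => i _ do rewrite /pair_scale (unsplitK (inr i)).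
by rewrite prodr_const card_ord.
Qed.

Lemma gauss_inv_pair_scale d a b (u w : 'rV[R]_d) :
  gauss (fun i => (pair_scale a b i)^-1) (row_mx u w) =
  gauss (fun=> a^-1) u * gauss (fun=> b^-1) w.
Proof.
rewrite -gauss_pair_scale; apply: eq_bigr => i _.
by rewrite /pair_scale; case: fintype.split.
Qed.

Lemma gaussN n (c : 'I_n -> R) v : gauss c (- v) = gauss c v.
Proof.
by apply: eq_bigr => i _; rewrite mxE /gauss1 mulrN sqrrN.
Qed.

(** The symplectic transform is the ordinary Fourier transform evaluated at the rotated point
    (zeta_2, - zeta_1). *)
Lemma symplectic_fourier_gauss d (c : 'I_(d + d) -> R) zeta :
  (forall i, 0 < c i) ->
  symplectic_fourier (fun z => (gauss c z)%:C%C) zeta =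
  ((\prod_i (c i)^-1) * gauss (fun i => (c i)^-1)
    (row_mx (rsubmx zeta) (- lsubmx zeta)))%:C%C.
Proof.
move=> c0; pose xi := row_mx (rsubmx zeta) (- lsubmx zeta).
have sE z : symplectic zeta z = dot xi z.
  rewrite -{2}(hsubmxK z) dot_row_mx /symplectic; congr (_ + _).
  rewrite /dot -sumrN; apply: eq_bigr => i _; by rewrite !mxE mulNr.
rewrite /symplectic_fourier /cintegral; congr Complex.
  transitivity (\int[rmu (d + d)]_z (cos (2 * pi * dot xi z + 0) * gauss c z)).
    by apply: eq_Rintegral => z _; rewrite /= sE cosN mulr0 subr0 addr0.
  by rewrite Rintegral_gauss_cos// cos0 mul1r.
(* The imaginary part is the same integral with phase pi / 2, because - sin u = cos (u + pi / 2); it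
   vanishes with cos (pi / 2). *)
transitivity (\int[rmu (d + d)]_z (cos (2 * pi * dot xi z + pi / 2) * gauss c z)).
  apply: eq_Rintegral => z _; rewrite /= sE sinN mulr0 add0r.
  by rewrite cosD cos_pihalf sin_pihalf; ring.
by rewrite Rintegral_gauss_cos// cos_pihalf mul0r mulr0.
Qed.

(** The rotation exchanges the two blocks, whence the widths [b^-1] and [a^-1] in this order; the
    reflection in the duality formula disappears because Gaussians are even. *)
Lemma Re_Theta_sigma_gauss d a b : 0 < a -> 0 < b ->
  complex.Re (Theta_sigma R d (fun z => (gauss (pair_scale a b) z)%:C%C)) =
  \int[rmu (d + d)]_z (sinc (dot (lsubmx z) (rsubmx z)) *
    (a^-1 ^+ d * b^-1 ^+ d * gauss (pair_scale b^-1 a^-1) z)).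
Proof.
move=> a0 b0; apply: eq_Rintegral => z _.
rewrite symplectic_fourier_gauss; last exact: pair_scale_gt0.
rewrite /= mul0r subr0; congr (_ * (_ * _)); first exact: prod_pair_scale.
rewrite gauss_inv_pair_scale -{3}(hsubmxK z) gauss_pair_scale mulrC.
congr (_ * _); last by rewrite !linearN gaussN.
by rewrite !linearN opprK.
Qed.

End theta_gauss.

(** * The function sinc as an average of cosines *)

Section sinc_integral.
Context {R : realType}.
Local Notation mu := (@lebesgue_measure R).
Local Notation rmu := (@lebesgue_row R).
Local Notation chi := (\1_(`[0, 1]%classic : set R) : R -> R).

(** Moving the domain of t into the integrand puts the double integrals on a full product space,
    ready for Tonelli's theorem. *)
Lemma integral_chi (f : R -> R) :
  (\int[mu]_t (chi t * f t)%:E = \int[mu]_(t in `[0%R, 1%R]) (f t)%:E)%E.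
Proof.
rewrite [RHS]integral_mkcond; apply: eq_integral => t _.
rewrite patchE indicE; by case: ifPn => _; rewrite ?mul1r ?mul0r.
Qed.

Lemma continuous_cos_pi (u : R) : continuous (fun t => cos (pi * t * u)).
Proof.
rewrite (_ : (fun t => _) = (fun t => cos (pi * u * t + 0))).
  exact: continuous_cos_affine.
by apply/funext => t; rewrite addr0 mulrAC.
Qed.

(** For u nonzero, a primitive is t + sin (pi u t) / (pi u); at u = 0 the integrand is constant and
    the convention sinc 0 = 1 fits. The summand 1 makes the integrand nonnegative. *)
Lemma integral_cos_sinc (u : R) :
  (\int[mu]_t (chi t * (1 + cos (pi * t * u)))%:E = (1 + sinc u)%:E)%E.
Proof.
rewrite integral_chi /sinc; have [->|u0] := eqVneq u 0.
  under eq_integral do rewrite mulr0 cos0.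
  by rewrite integral_cst//= lebesgue_measure_itv/= lte01 oppr0 adde0 mule1.
have pu0 : pi * u != 0 by rewrite mulf_neq0// gt_eqF// pi_gt0.
pose F (t : R) := t + (pi * u)^-1 * sin (pi * u * t + 0).
have dF (t : R) : is_derive t 1 F (1 + cos (pi * t * u)).
  have ds := is_derive_sin_affine (pi * u) 0 t.
  apply: is_derive_eq; rewrite /GRing.scale/= mulKf// addr0; congr (_ + cos _).
  by rewrite mulrAC.
have cF : continuous F.
  move=> x; apply: differentiable_continuous.
  by apply/derivable1_diffP; have [] := dF x.
rewrite (@continuous_FTC2 _ _ F)//.
- by rewrite -EFinB /F !(mulr1, mulr0, addr0, sin0, subr0) [X in 1 + X]mulrC.
- apply: continuous_subspaceT => x; apply: cvgD; first exact: cvg_cst.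
  exact: continuous_cos_pi.
- split.
  + by move=> x _; have [] := dF x.
  + exact: cvg_at_right_filter (cF _).
  + exact: cvg_at_left_filter (cF _).
- by move=> x _; rewrite derive1E; have [_ ->] := dF x.
Qed.

Lemma chi_ge0 t : 0 <= chi t. Proof. by rewrite indicE. Qed.

Lemma cosD1_ge0 (t : R) : 0 <= 1 + cos t.
Proof. by have := cos_geN1 t; rewrite -subr_ge0 opprK addrC. Qed.

(** In the integral formula, 1 + cos lies between 0 and 2. *)
Lemma norm_sinc_le1 (u : R) : `|sinc u| <= 1.
Proof.
have h0 : 0 <= 1 + sinc u.
  rewrite -lee_fin -integral_cos_sinc; apply: integral_ge0 => t _.
  by rewrite lee_fin mulr_ge0 ?chi_ge0 ?cosD1_ge0.
have h2 : 1 + sinc u <= 2.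
  rewrite -lee_fin -integral_cos_sinc integral_chi.
  have -> : 2%:E = (\int[mu]_(t in `[0%R, 1%R]) (2 : R)%:E)%E.
    by rewrite integral_cst//= lebesgue_measure_itv/= lte01 oppr0 adde0 mule1.
  apply: ge0_le_integral => //.
  - apply/measurable_EFinP/measurable_funTS; apply: measurable_funD => //.
    by apply: continuous_measurable_fun; exact: continuous_cos_pi.
  - by move=> t _; rewrite lee_fin; have := cos_le1 (pi * t * u); lra.
by rewrite ler_norml; apply/andP; split; lra.
Qed.

Lemma measurable_dot_halves d :
  measurable_fun setT (fun z : 'rV[R]_(d + d) => dot (lsubmx z) (rsubmx z)).
Proof.
apply: measurable_sum => i.
under eq_fun do rewrite /lsubmx /rsubmx !mxE.
by apply: measurable_funM; exact: (@measurable_coord _ (measurableTypeR R)).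
Qed.

Lemma measurable_chi_cos d (f : 'rV[R]_d -> R) (h : 'rV[R]_d -> R) :
  measurable_fun setT f -> measurable_fun setT h ->
  measurable_fun setT (fun zt : 'rV[R]_d * measurableTypeR R =>
    (chi zt.2 * (1 + cos (pi * zt.2 * f zt.1)) * h zt.1)%:E).
Proof.
move=> mf mh; apply/measurable_EFinP; apply: measurable_funM; last first.
  by apply: measurableT_comp => //; exact: measurable_fst.
apply: measurable_funM.
  by apply: measurableT_comp; [exact: measurable_indic|exact: measurable_snd].
apply: measurable_funD => //; apply: measurableT_comp.
  by apply: continuous_measurable_fun; exact: continuous_cos.
apply: measurable_funM.
  by apply: measurable_funM => //; exact: measurable_snd.
by apply: measurableT_comp => //; exact: measurable_fst.
Qed.

(** Tonelli's theorem makes the integral over the parameter t measurable in z, so the case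
    distinction in [sinc] need not be examined. *)
Lemma measurable_sinc_comp d (f : 'rV[R]_d -> R) :
  measurable_fun setT f -> measurable_fun setT (fun z => sinc (f z)).
Proof.
move=> mf.
have : measurable_fun setT (fun z : 'rV[R]_d =>
    (\int[mu]_t (chi t * (1 + cos (pi * t * f z)) * 1)%:E)%E).
  have m1 : measurable_fun [set: 'rV[R]_d] (fun=> 1 : R) by [].
  have := measurable_fun_fubini_tonelli_F (m2 := mu) _ (measurable_chi_cos mf m1).
  apply=> x; by rewrite lee_fin mulr1 mulr_ge0 ?chi_ge0 ?cosD1_ge0.
rewrite (_ : (fun z => _) = (fun z => (1 + sinc (f z))%:E)); last first.
  by apply/funext => z; under eq_integral do rewrite mulr1; exact: integral_cos_sinc.
move=> /measurable_EFinP m1.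
rewrite (_ : (fun z => _) = (fun z => (1 + sinc (f z)) - 1)).
  exact: measurable_funB.
by apply/funext => z; rewrite addrC addKr.
Qed.

End sinc_integral.

(** * Closed form of the pairing with Gaussians *)

Section theta_value.
Context {R : realType}.
Local Notation mu := (@lebesgue_measure R).
Local Notation rmu := (@lebesgue_row R).
Local Notation chi := (\1_(`[0, 1]%classic : set R) : R -> R).

(** The integrand of I (s); the power - d / 2 is a d-th power of an inverse square root, one factor
    for each coordinate of w. *)
Definition theta_density d (s t : R) : R :=
  (Num.sqrt (1 + (s * t / 2) ^+ 2))^-1 ^+ d.

(** Squared widths add up: a^-2 + (b t / 2)^2 = a^-2 (1 + (a b t / 2)^2). *)
Lemma gauss_mul_dilate d (a b t : R) (w : 'rV[R]_d) : a != 0 ->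
  gauss (fun=> a^-1) w * gauss (fun=> b) ((t / 2) *: w) =
  gauss (fun=> a^-1 * Num.sqrt (1 + (a * b * t / 2) ^+ 2)) w.
Proof.
move=> a0; rewrite /gauss -big_split; apply: eq_bigr => i _ /=.
rewrite /gauss1 -expRD mxE; congr expR.
rewrite [in RHS]exprMn [X in _ = - (_ * (X * _))]exprMn.
rewrite sqr_sqrtr; last by rewrite addr_ge0 ?sqr_ge0.
by field.
Qed.

(** For fixed w, pi t (x w) = 2 pi ((t / 2) w) x, so the integral over x is a Gaussian transform at
    frequency (t / 2) w; its product with the Gaussian in w is again a Gaussian. The prefactor
    normalises the mass to 1, which accounts for the summand 1. *)
Lemma integral_cos_gauss_halves d (a b t : R) : 0 < a -> 0 < b ->
  (\int[rmu (d + d)]_z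
     ((1 + cos (pi * t * dot (lsubmx z) (rsubmx z))) *
      (a^-1 ^+ d * b^-1 ^+ d * gauss (pair_scale b^-1 a^-1) z))%:E =
   (1 + theta_density d (a * b) t)%:E)%E.
Proof.
move=> a0 b0; have an0 : a != 0 by rewrite gt_eqF.
have bn0 : b != 0 by rewrite gt_eqF.
have ia0 : 0 < a^-1 by rewrite invr_gt0.
have ib0 : 0 < b^-1 by rewrite invr_gt0.
have k0 : 0 <= a^-1 ^+ d * b^-1 ^+ d by rewrite mulr_ge0 ?exprn_ge0 ?ltW.
pose q := Num.sqrt (1 + (a * b * t / 2) ^+ 2).
have q0 : 0 < q.
  by rewrite sqrtr_gt0 (lt_le_trans ltr01)// lerDl sqr_ge0.
have mF m (f : 'rV[R]_m -> R) : measurable_fun setT f ->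
    measurable_fun setT (fun v => 1 + cos (pi * t * f v)).
  move=> mf; apply: measurable_funD => //; apply: measurableT_comp.
    by apply: continuous_measurable_fun; exact: continuous_cos.
  exact: measurable_funM.
rewrite ge0_integral_row_mx; last 2 first.
- by move=> z; rewrite lee_fin mulr_ge0 ?cosD1_ge0// mulr_ge0 ?gauss_ge0.
- apply/measurable_EFinP; apply: measurable_funM.
    by apply: mF; exact: measurable_dot_halves.
  by apply: measurable_funM => //; exact: measurable_gauss.
transitivity (\int[rmu d]_w ((a^-1 ^+ d * gauss (fun=> a^-1) w)%:E +
    (a^-1 ^+ d * gauss (fun=> a^-1 * q) w)%:E))%E.
  apply: eq_integral => w _.
  transitivity (\int[rmu d]_u ((a^-1 ^+ d * b^-1 ^+ d * gauss (fun=> a^-1) w)%:E *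
    ((1 + 1 * cos (2 * pi * dot ((t / 2) *: w) u + 0)) *
     gauss (fun=> b^-1) u)%:E))%E.
    apply: eq_integral => u _; rewrite row_mxKl row_mxKr gauss_pair_scale -EFinM.
    congr EFin.
    have -> : 2 * pi * dot ((t / 2) *: w) u + 0 = pi * t * dot u w.
      rewrite addr0 /dot !mulr_sumr; apply: eq_bigr => i _; rewrite mxE.
      by field.
    by ring.
  rewrite ge0_integralZl//; last 3 first.
  - by apply/measurable_EFinP; exact: measurable_cos_gauss.
  - by move=> u _; rewrite lee_fin mulr_ge0 ?gauss_ge0 ?cos_affine_ge0 ?normr1.
  - by rewrite lee_fin mulr_ge0 ?gauss_ge0.
  rewrite integral_gauss_cos ?normr1// -EFinM -EFinD; congr EFin.
  rewrite -gauss_mul_dilate// cos0 prodr_const card_ord !invrK.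
  have -> : b ^+ d = (b^-1 ^+ d)^-1 by rewrite exprVn invrK.
  rewrite mul1r mulrDr mulr1.
  have bd : b^-1 ^+ d != 0 by rewrite expf_neq0// gt_eqF.
  by field.
rewrite ge0_integralD//; last 4 first.
- by move=> w _; rewrite lee_fin mulr_ge0 ?gauss_ge0 ?exprn_ge0 ?ltW.
- apply/measurable_EFinP; apply: measurable_funM => //; exact: measurable_gauss.
- by move=> w _; rewrite lee_fin mulr_ge0 ?gauss_ge0 ?exprn_ge0 ?ltW.
- apply/measurable_EFinP; apply: measurable_funM => //; exact: measurable_gauss.
have EI r : 0 < r -> (\int[rmu d]_w (a^-1 ^+ d * gauss (fun=> r) w)%:E =
    ((a * r)^-1 ^+ d)%:E)%E.
  move=> r0; under eq_integral do rewrite EFinM.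
  rewrite ge0_integralZl//; last 3 first.
  - by apply/measurable_EFinP; exact: measurable_gauss.
  - by move=> w _; rewrite lee_fin gauss_ge0.
  - by rewrite lee_fin exprn_ge0// ltW.
  rewrite integral_gauss// prodr_const card_ord -EFinM; congr EFin.
  by rewrite -exprMn invfM.
rewrite !EI ?mulr_gt0// mulfV// mulVKf// invr1 expr1n -EFinD.
by [].
Qed.

Lemma integral_sinc_gauss d (a b : R) : 0 < a -> 0 < b ->
  (\int[rmu (d + d)]_z
     ((1 + sinc (dot (lsubmx z) (rsubmx z))) *
      (a^-1 ^+ d * b^-1 ^+ d * gauss (pair_scale b^-1 a^-1) z))%:E =
   \int[mu]_(t in `[0%R, 1%R]) (1 + theta_density d (a * b) t)%:E)%E.
Proof.
move=> a0 b0.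
pose h (z : 'rV[R]_(d + d)) :=
  a^-1 ^+ d * b^-1 ^+ d * gauss (pair_scale b^-1 a^-1) z :> R.
have h0 z : 0 <= h z.
  by rewrite !mulr_ge0 ?gauss_ge0// exprn_ge0// invr_ge0 ltW.
have mh : measurable_fun setT h.
  by apply: measurable_funM => //; exact: measurable_gauss.
pose f (z : 'rV[R]_(d + d)) := dot (lsubmx z) (rsubmx z).
have mf : measurable_fun setT f by exact: measurable_dot_halves.
pose F (zt : 'rV[R]_(d + d) * measurableTypeR R) :=
  (chi zt.2 * (1 + cos (pi * zt.2 * f zt.1)) * h zt.1)%:E.
transitivity (\int[rmu (d + d)]_z \int[mu]_t F (z, t))%E.
  apply: eq_integral => z _.
  rewrite EFinM -integral_cos_sinc -ge0_integralZr//; last 2 first.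
  - apply/measurable_EFinP; apply: measurable_funM; first exact: measurable_indic.
    apply: measurable_funD => //; apply: continuous_measurable_fun.
    exact: continuous_cos_pi.
  - by rewrite lee_fin h0.
rewrite (fubini_tonelli F); last 2 first.
- exact: measurable_chi_cos.
- move=> x; rewrite lee_fin; apply: mulr_ge0; last exact: h0.
  by rewrite mulr_ge0 ?chi_ge0 ?cosD1_ge0.
rewrite -integral_chi; apply: eq_integral => t _.
rewrite EFinM -integral_cos_gauss_halves// -ge0_integralZl//; last 2 first.
- apply/measurable_EFinP; apply: measurable_funM => //.
  apply: measurable_funD => //; apply: measurableT_comp.
    by apply: continuous_measurable_fun; exact: continuous_cos.
  exact: measurable_funM.
- by move=> z _; rewrite lee_fin mulr_ge0 ?cosD1_ge0//; exact: h0.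
by apply: eq_integral => z _; rewrite /F/= -EFinM -mulrA.
Qed.

Lemma continuous_theta_density d s : continuous (@theta_density d s).
Proof.
move=> t; apply: (@continuous_comp _ _ _
  (fun t => (Num.sqrt (1 + (s * t / 2) ^+ 2))^-1) (fun x => x ^+ d)); last first.
  exact: exprn_continuous.
apply: cvgV.
  by rewrite gt_eqF// sqrtr_gt0 (lt_le_trans ltr01)// lerDl sqr_ge0.
apply: (@continuous_comp _ _ _ (fun t => 1 + (s * t / 2) ^+ 2)); last first.
  exact: sqrt_continuous.
apply: cvgD; first exact: cvg_cst.
apply: (@continuous_comp _ _ _ (fun t => s * t / 2) (fun x => x ^+ 2)); last first.
  exact: exprn_continuous.
by apply: cvgM; [apply: cvgM; [exact: cvg_cst|exact: cvg_id]|exact: cvg_cst].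
Qed.

(** The summand 1 contributes the mass of the normalised Gaussian on one side and the length of
    [0, 1] on the other; both are 1 and cancel. *)
Lemma Re_Theta_sigma_gaussE d a b : 0 < a -> 0 < b ->
  complex.Re (Theta_sigma R d (fun z => (gauss (pair_scale a b) z)%:C%C)) =
  \int[mu]_(t in `[0, 1]) theta_density d (a * b) t.
Proof.
move=> a0 b0; rewrite Re_Theta_sigma_gauss//.
have ia0 : 0 < a^-1 by rewrite invr_gt0.
have ib0 : 0 < b^-1 by rewrite invr_gt0.
pose k := a^-1 ^+ d * b^-1 ^+ d.
have intg : (rmu (d + d)).-integrable setT
    (EFin \o (fun z => k * gauss (pair_scale b^-1 a^-1) z)).
  by apply: integrable_scale; apply: integrable_gauss; exact: pair_scale_gt0.
have ints : (rmu (d + d)).-integrable setT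
    (EFin \o (fun z => k * gauss (pair_scale b^-1 a^-1) z *
      sinc (dot (lsubmx z) (rsubmx z)))).
  apply: integrable_mul_le1 => //; last by move=> z; exact: norm_sinc_le1.
  by apply: measurable_sinc_comp; exact: measurable_dot_halves.
have intd : mu.-integrable `[0, 1] (EFin \o theta_density d (a * b)).
  apply: continuous_compact_integrable; first exact: segment_compact.
  by apply: continuous_subspaceT; exact: continuous_theta_density.
have int1 : mu.-integrable `[0, 1] (EFin \o (cst 1 : R -> R)).
  apply: continuous_compact_integrable; first exact: segment_compact.
  by apply: continuous_subspaceT; exact: cst_continuous.
have := congr1 fine (@integral_sinc_gauss d a b a0 b0).
rewrite -/(Rintegral mu `[0, 1] (fun t => 1 + theta_density d (a * b) t)).
rewrite RintegralD//.
have -> : \int[mu]_(t in `[0, 1]) (1 : R) = 1.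
  have := @Rintegral_cst _ _ _ mu `[0, 1]%classic (measurable_itv _) (1 : R).
  by rewrite /= lebesgue_measure_itv/= lte01 oppr0 adde0 mulr1.
under eq_integral do rewrite mulrDl mul1r [_ * (_ * _)]mulrC -/k.
rewrite -/(Rintegral (rmu (d + d)) setT
  (fun z => k * gauss (pair_scale b^-1 a^-1) z +
  k * gauss (pair_scale b^-1 a^-1) z * sinc (dot (lsubmx z) (rsubmx z)))).
rewrite RintegralD//.
have -> : \int[rmu (d + d)]_z (k * gauss (pair_scale b^-1 a^-1) z) = 1.
  rewrite RintegralZl//; last by apply: integrable_gauss; exact: pair_scale_gt0.
  rewrite /Rintegral integral_gauss; last exact: pair_scale_gt0.
  rewrite prod_pair_scale !invrK /= /k -!exprMn mulrA mulfVK ?gt_eqF//.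
  by rewrite mulVf ?gt_eqF// expr1n.
move=> /addrI <-; apply: eq_Rintegral => z _; by rewrite mulrC.
Qed.

End theta_value.

(** * Lower bounds and conclusion *)

Section theta_lower_bounds.
Context {R : realType}.
Local Notation mu := (@lebesgue_measure R).
Implicit Types (d : nat) (s t : R).

Lemma integrable_theta_density d s :
  mu.-integrable `[0, 1] (EFin \o theta_density d s).
Proof.
apply: continuous_compact_integrable; first exact: segment_compact.
by apply: continuous_subspaceT; exact: continuous_theta_density.
Qed.

(** On [0, 1] the radicand 1 + (t / 2)^2 is at most 2, so the integrand is at least a positive
    constant. *)
Lemma theta_density_integral_gt0 d :
  0 < \int[mu]_(t in `[0, 1]) theta_density d 1 t.
Proof.
have k0 : 0 < (Num.sqrt 2)^-1 ^+ d :> R by rewrite exprn_gt0// invr_gt0 sqrtr_gt0.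
apply: (lt_le_trans k0).
have -> : (Num.sqrt 2)^-1 ^+ d =
    \int[mu]_(t in `[0, 1]) (cst ((Num.sqrt 2)^-1 ^+ d : R) t).
  rewrite Rintegral_cst; last exact: measurable_itv.
  by rewrite /= lebesgue_measure_itv/= lte01 oppr0 adde0 mulr1.
apply: le_Rintegral => //.
- apply: continuous_compact_integrable; first exact: segment_compact.
  by apply: continuous_subspaceT; exact: cst_continuous.
- exact: integrable_theta_density.
- move=> t; rewrite /= in_itv/= => /andP[t0 t1].
  have q0 : 0 < Num.sqrt (1 + (1 * t / 2) ^+ 2) :> R.
    by rewrite sqrtr_gt0 (lt_le_trans ltr01)// lerDl sqr_ge0.
  rewrite /theta_density lerXn2r ?nnegrE ?invr_ge0 ?sqrtr_ge0//.
  rewrite lef_pV2 ?posrE ?sqrtr_gt0//; last by rewrite -sqrtr_gt0.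
  by rewrite ler_sqrt ?posrE//; nra.
Qed.

(** Since sqrt (1 + u^2) <= 1 + u for u >= 0, s^d times the density is at least y^d with y = s / (1
    + s t / 2). As s >= 1 and t <= 1 give y >= 2 / 3, the power (3 y / 2)^d is at least 3 y / 2. The
    integral of y is 2 ln (1 + s / 2), which the choice of s makes equal to 2 l. *)
Lemma theta_density_integral_ge d (l : R) : (0 < d)%N -> 1 <= l ->
  forall s, s = 2 * (expR l - 1) ->
  (2 / 3) ^+ d * 3 * l <= s ^+ d * \int[mu]_(t in `[0, 1]) theta_density d s t.
Proof.
move=> d0 l1 s sE; have s1 : 1 <= s.
  by have := expR_ge1Dx l; rewrite sE; lra.
have s0 : 0 < s := lt_le_trans ltr01 s1.
rewrite -RintegralZl//; last exact: integrable_theta_density.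
pose k : R := (2 / 3) ^+ d * 3.
pose f t := k * (s / 2) / (1 + s / 2 * t).
pose F t := k * ln (1 + s / 2 * t).
have den0 t : 0 <= t -> 0 < 1 + s / 2 * t.
  by move=> t0; rewrite ltr_wpDr// mulr_ge0// divr_ge0// ltW.
have dF t : 0 <= t -> is_derive t 1 F (f t).
  move=> t0; have d1 : is_derive t 1 (fun t => 1 + s / 2 * t) (s / 2).
    by apply: is_derive_eq; rewrite /GRing.scale/=; ring.
  have d2 := @is_derive1_comp _ (@ln R) (fun t => 1 + s / 2 * t) t _ _
    (is_derive1_ln (den0 _ t0)) d1.
  have d3 := is_deriveZ k d2.
  apply: (@is_derive_eq _ _ _ _ _ _ _ _ d3); rewrite /f /GRing.scale/=.
  by ring.
have cf : {within `[0, 1], continuous f}.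
  apply: continuous_in_subspaceT => t; rewrite inE/= in_itv/= => /andP[t0 t1].
  apply: cvgM; first exact: cvg_cst.
  apply: cvgV; first by rewrite gt_eqF// den0.
  by apply: cvgD; [exact: cvg_cst|apply: cvgM; [exact: cvg_cst|exact: cvg_id]].
have cF t : 0 <= t -> {for t, continuous F}.
  move=> t0; apply: differentiable_continuous.
  by apply/derivable1_diffP; have [] := dF t t0.
have -> : (2 / 3) ^+ d * 3 * l = \int[mu]_(t in `[0, 1]) f t.
  rewrite /Rintegral (@continuous_FTC2 _ f F)//.
  - rewrite /F mulr1 mulr0 addr0 ln1 mulr0 sube0 /=.
    have -> : 1 + s / 2 = expR l by rewrite sE; field.
    by rewrite expRK.
  - split.
    + by move=> t; rewrite in_itv/= => /andP[/ltW t0 _]; have [] := dF t t0.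
    + exact: cvg_at_right_filter (cF _ (lexx _)).
    + exact: cvg_at_left_filter (cF _ ler01).
  - move=> t; rewrite in_itv/= => /andP[/ltW t0 _].
    by rewrite derive1E; have [_ ->] := dF t t0.
apply: le_Rintegral => //.
- by apply: continuous_compact_integrable => //; exact: segment_compact.
- apply: continuous_compact_integrable; first exact: segment_compact.
  apply: continuous_subspaceT => x.
  by apply: cvgM; [exact: cvg_cst|exact: continuous_theta_density].
- move=> t; rewrite /= in_itv/= => /andP[t0 t1].
  pose y := s / (1 + s / 2 * t).
  have dt := den0 t t0.
  have y23 : 1 <= 3 / 2 * y by rewrite /y mulrA ler_pdivlMr//; nra.
  have -> : f t = (2 / 3) ^+ d * (3 / 2 * y).
    by rewrite /f /k /y; ring.
  apply: (@le_trans _ _ ((2 / 3) ^+ d * (3 / 2 * y) ^+ d)).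
    by rewrite ler_wpM2l ?exprn_ge0 ?divr_ge0// ler_eXnr.
  rewrite -exprMn /theta_density -exprMn.
  have -> : 2 / 3 * (3 / 2 * y) = y by field.
  have st : s * t / 2 = s / 2 * t by rewrite mulrAC.
  have q0 : 0 < Num.sqrt (1 + (s / 2 * t) ^+ 2).
    by rewrite sqrtr_gt0 (lt_le_trans ltr01)// lerDl sqr_ge0.
  rewrite st; apply: lerXn2r.
  - by rewrite nnegrE divr_ge0 ?ltW.
  - by rewrite nnegrE divr_ge0 ?ltW.
  rewrite ler_pM2l// lef_pV2 ?posrE//.
  rewrite -[leRHS](ger0_norm (ltW dt)) -sqrtr_sqr ler_sqrt ?sqr_ge0//.
  by rewrite sqrrD expr1n mul1r lerD2r lerDl mulrn_wge0// mulr_ge0// divr_ge0// ltW.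
Qed.

End theta_lower_bounds.

(** * Contradiction for bounded functions and for finite exponents *)

Section not_Lp.
Context {R : realType}.
Local Notation mu := (@lebesgue_measure R).
Local Notation rmu := (@lebesgue_row R).

(** Through [row_cons] this hyperplane is the product of a point of the line with R^n. *)
Lemma null_first_coord n :
  \forall z \ae rmu n.+1, (z : 'rV[R]_n.+1) ord0 ord0 != 0.
Proof.
pose A := [set z : 'rV[measurableTypeR R]_n.+1 | z ord0 ord0 = 0].
have mA : measurable A.
  have := @measurable_coord _ (measurableTypeR R) n.+1 ord0 measurableT [set 0].
  by rewrite setTI; apply; exact: measurable_set1.
exists A; split => //; last by move=> z /= /negP; rewrite negbK => /eqP.
transitivity ((mu \x rmu n)%E ([set 0] `*` [set: 'rV[R]_n])).
  rewrite /= /row_cons_measure /pushforward; congr product_measure1.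
  apply/seteqP; split => -[x v] /=; rewrite /A /= row_cons0; first by [].
  by case.
rewrite product_measure1E// [X in (X * _)%E](_ : _ = 0%E) ?mul0e//.
exact: lebesgue_measure_set1.
Qed.

Lemma abs_Re_le_normc (x : R[i]) : `|complex.Re x| <= Normc.normc x.
Proof.
case: x => a b /=; rewrite -sqrtr_sqr ler_sqrt ?lerDl ?sqr_ge0//.
by rewrite addr_ge0 ?sqr_ge0.
Qed.

Lemma normc_ge0 (x : R[i]) : 0 <= Normc.normc x.
Proof. by case: x => a b /=; exact: sqrtr_ge0. Qed.

(** The common start of both contradictions. Only the real part of g is kept, as the real part of
    the pairing is already I (a b). *)
Lemma theta_integral_le d (g : 'rV[R]_(d + d) -> R[i]) a b :
  measurable_fun setT (fun z => complex.Re (g z)) ->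
  eq_distribution (Theta_sigma R d) (regular_distribution g) ->
  0 < a -> 0 < b ->
  ((\int[mu]_(t in `[0%R, 1%R]) theta_density d (a * b) t)%:E <=
   \int[rmu (d + d)]_z (`|complex.Re (g z)| * gauss (pair_scale a b) z)%:E)%E.
Proof.
move=> mg eqg a0 b0.
have := congr1 (@complex.Re R) (eqg _ (schwartz_gauss (pair_scale_gt0 a0 b0))).
rewrite Re_Theta_sigma_gaussE// => ->.
rewrite [X in (X%:E <= _)%E](_ : _ = \int[rmu (d + d)]_z
    (complex.Re (g z) * gauss (pair_scale a b) z)); last first.
  by apply: eq_Rintegral => z _ /=; case: (g z) => x y /=; rewrite mulr0 subr0.
have mf : measurable_fun setT
    (fun z => (complex.Re (g z) * gauss (pair_scale a b) z)%:E).
  by apply/measurable_EFinP; apply: measurable_funM => //; exact: measurable_gauss.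
apply: (@le_trans _ _ `|\int[rmu (d + d)]_z
    (complex.Re (g z) * gauss (pair_scale a b) z)%:E|%E).
  (* The integral may be infinite at this point: then [fine] returns 0, which is below the absolute
     value +oo. *)
  rewrite /Rintegral; case: (\int[rmu (d + d)]_z _)%E => [r| |] /=.
  - by rewrite lee_fin ler_norm.
  - by rewrite leey.
  - by rewrite leey.
apply: (le_trans (le_abse_integral (rmu (d + d)) measurableT mf)).
rewrite le_eqVlt; apply/orP; left; apply/eqP; apply: eq_integral => z _.
by rewrite /= normrM (ger0_norm (gauss_ge0 _ _)).
Qed.

Lemma integral_gauss_pair d (a b : R) : 0 < a -> 0 < b ->
  (\int[rmu (d + d)]_z (gauss (pair_scale a b) z)%:E = ((a * b)^-1 ^+ d)%:E)%E.
Proof.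
move=> a0 b0; rewrite integral_gauss; last exact: pair_scale_gt0.
by rewrite prod_pair_scale -exprMn invfM.
Qed.

Lemma not_bounded_Theta_sigma d (C : R) (g : 'rV[R]_(d + d) -> R[i]) :
  (0 < d)%N -> measurable_fun setT (fun z => complex.Re (g z)) ->
  (\forall z \ae (rmu (d + d)), `|complex.Re (g z)| <= C) -> 0 <= C ->
  ~ eq_distribution (Theta_sigma R d) (regular_distribution g).
Proof.
move=> d0 mg gC C0 eqg.
pose k : R := (2 / 3) ^+ d * 3.
have k0 : 0 < k by rewrite mulr_gt0// exprn_gt0// divr_gt0.
(* Chosen so that k l = C + k exceeds C. *)
pose l := C / k + 1.
have l1 : 1 <= l by rewrite lerDr divr_ge0// ltW.
pose s := 2 * (expR l - 1).
have s0 : 0 < s by have := expR_ge1Dx l; rewrite /s; lra.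
have := theta_density_integral_ge d0 l1 (erefl s).
rewrite -/s -/k; set T := Rintegral _ _ _ => kl.
have TC : (T%:E <= (C * (s * 1)^-1 ^+ d)%:E)%E.
  have := theta_integral_le mg eqg s0 ltr01; rewrite mulr1 => /le_trans; apply.
  rewrite EFinM -[s in leRHS]mulr1 -integral_gauss_pair//.
  rewrite -ge0_integralZl//; last 2 first.
  - by apply/measurable_EFinP; exact: measurable_gauss.
  - by move=> z _; rewrite lee_fin gauss_ge0.
  apply: ae_ge0_le_integral => //.
  - by move=> z _; rewrite lee_fin mulr_ge0 ?gauss_ge0.
  - apply/measurable_EFinP; apply: measurable_funM; last exact: measurable_gauss.
    exact: measurableT_comp.
  - by move=> z _; rewrite -EFinM lee_fin mulr_ge0 ?gauss_ge0.
  - by apply/measurable_EFinP; apply: measurable_funM => //; exact: measurable_gauss.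
  - move: gC; apply: filterS => z gz _.
    by rewrite -EFinM lee_fin ler_wpM2r ?gauss_ge0.
have : s ^+ d * T <= C.
  move: TC; rewrite lee_fin mulr1 exprVn ler_pdivlMr ?exprn_gt0//.
  by rewrite mulrC.
move=> /(le_trans kl); rewrite /l mulrDr mulr1 mulrCA mulfV ?gt_eqF// mulr1.
by rewrite gerDl leNgt k0.
Qed.

Lemma cvg_gauss_squeeze n (z : 'rV[R]_n.+1) (c : nat -> 'I_n.+1 -> R) i :
  (forall m, c m i = m.+1%:R) -> z 0 i != 0 ->
  gauss (c m) z @[m --> \oo] --> (0 : R).
Proof.
move=> ci z0.
have h : gauss1 `|z 0 i| m.+1%:R @[m --> \oo] --> (0 : R).
  have nz : 0 < `|z 0 i| by rewrite normr_gt0.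
  apply: (cvg_comp (fun m : nat => m.+1%:R : R) _ _ (cvgy_gauss1 nz)).
  by have := @cvgr_idn R; rewrite -(cvg_shiftS (fun n : nat => n%:R : R)).
apply: (squeeze_cvgr _ (cvg_cst 0) h).
apply: nearW => m; rewrite gauss_ge0/= /gauss (bigD1 i)//= ci.
(* Width and variable play symmetric roles in [gauss1], so decay in the width is decay in the
   variable. *)
have -> : gauss1 m.+1%:R (z 0 i) = gauss1 `|z 0 i| m.+1%:R.
  by rewrite /gauss1 !exprMn real_normK ?num_real// [z 0 i ^+ 2 * _]mulrC.
rewrite ler_piMr ?gauss1_ge0//.
by apply: prodr_ile1 => j _; rewrite gauss1_ge0 gauss1_le1.
Qed.

(** If x > e then x / e > 1, hence x / e <= (x / e)^r; otherwise e alone suffices. *)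
Lemma le_powR_split (x r e : R) : 0 <= x -> 1 <= r -> 0 < e ->
  x <= e + e * (e^-1 `^ r) * x `^ r.
Proof.
move=> x0 r1 e0; have [xe|ex] := leP x e.
  by rewrite (le_trans xe)// lerDl !mulr_ge0 ?powR_ge0 ?ltW.
have ie0 : 0 <= e^-1 by rewrite invr_ge0 ltW.
apply: (@le_trans _ _ (e * (e^-1 * x) `^ r)).
  apply: (@le_trans _ _ (e * (e^-1 * x))); first by rewrite mulVKf ?gt_eqF.
  by rewrite ler_wpM2l ?(ltW e0)// le1r_powR// mulrC ler_pdivlMr// mul1r ltW.
by rewrite powRM// mulrA lerDr (ltW e0).
Qed.

Lemma not_integrable_power_Theta_sigma d (r : R) (g : 'rV[R]_(d + d) -> R[i]) :
  (0 < d)%N -> 1 <= r -> measurable_fun setT (fun z => complex.Re (g z)) ->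
  (rmu (d + d)).-integrable setT (fun z => (`|complex.Re (g z)| `^ r)%:E) ->
  ~ eq_distribution (Theta_sigma R d) (regular_distribution g).
Proof.
(* With d a successor, the coordinate [ord0] exists and belongs to the x block, whose width m + 1
   tends to infinity. *)
case: d g => // d g _ r1 mg iW eqg.
pose W z := `|complex.Re (g z)| `^ r.
pose c m := @pair_scale R d.+1 m.+1%:R m.+1%:R^-1.
have m0 m : (0 : R) < m.+1%:R by [].
have im0 m : (0 : R) < m.+1%:R^-1 by rewrite invr_gt0.
have mW : measurable_fun setT W by have /measurable_EFinP := measurable_int _ iW.
have W0 z : 0 <= W z by exact: powR_ge0.
have cvgW : (\int[rmu (d.+1 + d.+1)]_z (W z * gauss (c m) z)%:E)%E @[m --> \oo]
    --> (0%E : \bar R).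
  pose f m z := (W z * gauss (c m) z)%:E.
  have mf m : measurable_fun setT (f m).
    by apply/measurable_EFinP; apply: measurable_funM => //; exact: measurable_gauss.
  have mf0 : measurable_fun [set: 'rV[R]_(d.+1 + d.+1)] (cst (0%E : \bar R)) by [].
  have f0 : {ae rmu (d.+1 + d.+1), forall z, setT z ->
      f^~ z @ \oo --> (cst (0%E : \bar R) : 'rV[R]_(d.+1 + d.+1) -> \bar R) z}.
    move: (@null_first_coord (d + d.+1)%N); apply: filterS => z z0 _.
    apply: cvg_EFin; first exact: nearW.
    rewrite -(mulr0 (W z)); apply: cvgM; first exact: cvg_cst.
    apply: (@cvg_gauss_squeeze _ z c ord0) => // m.
    rewrite /c /pair_scale; by case: fintype.splitP.
  have fW : {ae rmu (d.+1 + d.+1), forall z m, setT z -> (`|f m z| <= (W z)%:E)%E}.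
    apply: aeW => z m _; rewrite /f abse_EFin lee_fin normrM.
    by rewrite !ger0_norm ?gauss_ge0// ler_piMr// gauss_le1.
  have [_ _] := dominated_convergence measurableT mf mf0 f0 iW fW.
  by rewrite integral0.
have T0 := theta_density_integral_gt0 d.+1 (R := R).
set T := Rintegral _ _ _ in T0.
(* In the limit m -> oo the inequality below becomes T <= e, which any e < T contradicts. *)
pose e := T / 2.
have e0 : 0 < e by rewrite divr_gt0.
pose K := e * (e^-1 `^ r).
have K0 : 0 <= K by rewrite mulr_ge0 ?powR_ge0// ltW.
have TK m : (T%:E <= e%:E +
    K%:E * \int[rmu (d.+1 + d.+1)]_z (W z * gauss (c m) z)%:E)%E.
  have := theta_integral_le mg eqg (m0 m) (im0 m).
  rewrite mulfV ?gt_eqF// => /le_trans; apply.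
  have -> : e%:E = (\int[rmu (d.+1 + d.+1)]_z (e%:E * (gauss (c m) z)%:E))%E.
    rewrite ge0_integralZl//; last 3 first.
    - by apply/measurable_EFinP; exact: measurable_gauss.
    - by move=> z _; rewrite lee_fin gauss_ge0.
    - by rewrite lee_fin ltW.
    by rewrite integral_gauss_pair// mulfV ?gt_eqF// invr1 expr1n mule1.
  have mWg : measurable_fun setT (fun z => (W z * gauss (c m) z)%:E).
    by apply/measurable_EFinP; apply: measurable_funM => //; exact: measurable_gauss.
  rewrite -ge0_integralZl//; last first.
    by move=> z _; rewrite lee_fin mulr_ge0 ?gauss_ge0.
  have mg' : measurable_fun setT (fun z => (e%:E * (gauss (c m) z)%:E)%E).
    under eq_fun do rewrite -EFinM.
    by apply/measurable_EFinP; apply: measurable_funM => //; exact: measurable_gauss.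
  rewrite -ge0_integralD//; last 3 first.
  - by move=> z _; rewrite -EFinM lee_fin mulr_ge0 ?gauss_ge0// ltW.
  - by move=> z _; rewrite -EFinM lee_fin mulr_ge0// mulr_ge0 ?gauss_ge0.
  - exact: measurable_funeM.
  apply: ge0_le_integral => //.
  - by move=> z _; rewrite lee_fin mulr_ge0 ?gauss_ge0.
  - apply/measurable_EFinP; apply: measurable_funM; last exact: measurable_gauss.
    exact: measurableT_comp.
  - by apply: emeasurable_funD => //; exact: measurable_funeM.
  - move=> z _; rewrite -!EFinM -EFinD lee_fin mulrA -mulrDl.
    by rewrite ler_wpM2r ?gauss_ge0// le_powR_split.
have cvgK : (e%:E + K%:E * \int[rmu (d.+1 + d.+1)]_z (W z * gauss (c m) z)%:E)%E
   @[m --> \oo] --> (e%:E + K%:E * 0)%E.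
  by apply: cvgeD => //; [exact: cvg_cst|exact: cvgeZl].
have : (T%:E <= e%:E + K%:E * 0)%E.
  rewrite -(cvg_lim _ cvgK)//; apply: lime_ge.
    by apply/cvg_ex; eexists; exact: cvgK.
  by apply: nearW => m; exact: TK.
by rewrite mule0 adde0 lee_fin /e; lra.
Qed.

(** On a null space the Gaussian of mass 1 would have integral 0. For p = +oo, [Lnorm] branches on
    this positivity before taking the essential supremum. *)
Lemma row_measure_gt0 n : (0 < rmu n setT)%E.
Proof.
rewrite lt0e measure_ge0 andbT; apply/eqP => h0.
have := @integral_gauss R n (fun=> 1) (fun=> @ltr01 R).
rewrite null_set_integral//.
  by move=> [] /esym/eqP; rewrite prodr_const invr1 expr1n oner_eq0.
by apply/measurable_EFinP; exact: measurable_gauss.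
Qed.

End not_Lp.

Local Open Scope ereal_scope.

Theorem corollary3p6 (R : realType) (d : nat) (hd : (1 <= d)%N)
    (p : \bar R) (hp : 1 <= p) : ~ in_Lp p (Theta_sigma R d).
Proof.
move=> [g [mRe mIm Lg] eqg].
case: p hp Lg => [r| |] // hp Lg.
- move: hp; rewrite lee_fin => r1.
  have r0 : r != 0%R by rewrite gt_eqF// (lt_le_trans ltr01).
  apply: (not_integrable_power_Theta_sigma hd r1 mRe _ eqg).
  have mW : measurable_fun setT (fun z => (`|complex.Re (g z)| `^ r)%R).
    apply: (measurableT_comp (measurable_powR r)).
    exact: measurableT_comp.
  apply/integrableP; split; first exact/measurable_EFinP.
  have mN : measurable_fun setT (fun z => Normc.normc (g z)).
    rewrite (_ : (fun z => _) = (fun z => Num.sqrt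
      (complex.Re (g z) ^+ 2 + complex.Im (g z) ^+ 2)%R)).
      apply: measurableT_comp.
        by apply: continuous_measurable_fun; exact: sqrt_continuous.
      by apply: measurable_funD; exact: measurable_funX.
    by apply/funext => z; case: (g z).
  (* The comparison integral is the r-th power of the norm of g, finite by assumption. *)
  apply: (@le_lt_trans _ _ (\int[lebesgue_row (d + d)]_z
    `| (Normc.normc (g z))%:E | `^ r)).
    apply: ge0_le_integral => //.
    - by apply: measurableT_comp => //; exact/measurable_EFinP.
    - under eq_fun do rewrite abse_EFin poweR_EFin.
      apply/measurable_EFinP; apply: (measurableT_comp (measurable_powR r)).
      exact: measurableT_comp.
    - move=> z _; rewrite !abse_EFin poweR_EFin lee_fin.
      rewrite (ger0_norm (powR_ge0 _ _)) (ger0_norm (normc_ge0 _)).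
      by rewrite ge0_ler_powR ?nnegrE ?normc_ge0 ?abs_Re_le_normc// (le_trans ler01).
  by rewrite -powR_Lnorm//; exact: poweR_lty.
- move: Lg; rewrite unlock row_measure_gt0 => Lg.
  (* The maximum with 0 makes the bound nonnegative whatever the essential supremum; finiteness of
     the norm excludes the value +oo, which [fine] would send to 0. *)
  pose C := Num.max (fine (ess_sup (lebesgue_row (d + d))
    (abse \o (fun z => (Normc.normc (g z))%:E)))) 0%R.
  have C0 : (0 <= C)%R by rewrite le_max lexx orbT.
  apply: (not_bounded_Theta_sigma hd mRe _ C0 eqg).
  have := ess_sup_ge (lebesgue_row (d + d))
    (abse \o (fun z => (Normc.normc (g z))%:E)).
  apply: filterS => z /=; rewrite (ger0_norm (normc_ge0 _)) => gz.
  apply: (le_trans (abs_Re_le_normc _)).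
  move: Lg gz; rewrite /C; case: (ess_sup _ _) => [e| |] //= _.
  by rewrite lee_fin le_max => ->.
Qed.
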